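(* Let $K$ be a field of characteristic zero. For every $D\ge1$, the natural $\mathfrak{S}_D$-module structure on the space $\mathcal{SI}(D)$ of multilinear special identities of degree $D$ extends to an $\mathfrak{S}_{D+1}$-module structure, namely the one induced by the cyclic structure of the Jordan operad.
   Context: $K$ is a field of characteristic zero. A Jordan algebra is a commutative (not necessarily unital) $K$-algebra with $x^2(yx)=(x^2y)x$. For a vector space $V$: $J(V)$ is the free Jordan algebra on $V$; $T(V)$ is the free non-unital associative algebra on $V$; $SJ(V)\subset T(V)$ is the Jordan subalgebra generated by $V$ for the product $x\circ y=\frac12(xy+yx)$. Write $J(D)=J(K^D)$, $SJ(D)=SJ(K^D)$ with $K^D$ having basis $x_1,\dots,x_D$. Let $\mathcal{J}(D)$ and $\mathcal{SJ}(D)$ be the multilinear parts (degree one in each of $x_1,\dots,x_D$), on which $\mathfrak{S}_D$ acts by permuting the generators. $\mathcal{SI}(D)$ is the kernel of the natural surjection $\mathcal{J}(D)\to\mathcal{SJ}(D)$. Cyclic structure. For a Jordan algebra $A$ let $\mathcal{B}A=\Lambda^2A/\mathrm{span}\{a\wedge a^2\}$ and $\{a,b\}$ the class of $a\wedge b$. Let $K^{1+D}$ have basis $x_0,\dots,x_D$, and let $X_J(D+1)$ be the multilinear part (degree one in each of $x_0,\dots,x_D$) of the kernel of the map $J(K^{1+D})\otimes K^{1+D}\to\mathcal{B}J(K^{1+D})$, $a\otimes v\mapsto\{a,v\}$; $\mathfrak{S}_{D+1}$ acts on it by permuting $x_0,\dots,x_D$. Projection onto the component $J(K^D)\otimes x_0$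 is an $\mathfrak{S}_D$-equivariant isomorphism $X_J(D+1)\cong\mathcal{J}(D)$, which defines the $\mathfrak{S}_{D+1}$-action on $\mathcal{J}(D)$. *)

(* Defs.v *)
From HB Require Import structures.
From mathcomp Require Import all_boot all_order all_algebra all_fingroup.
From mathcomp Require Import generic_quotient ring_quotient.
From mathcomp Require Import finmap monalg boolp.

Set Implicit Arguments.
Unset Strict Implicit.
Unset Printing Implicit Defensive.

Import GRing.Theory.

Local Open Scope ring_scope.
Local Open Scope quotient_scope.

Section Span.
Variables (K : fieldType) (V : lmodType K) (P : V -> Prop).

Inductive in_span : V -> Prop :=
| in_span0 : in_span 0
| in_spanD u v : in_span u -> in_span v -> in_span (u + v)
| in_spanZ a v : in_span v -> in_span (a *: v)
| in_span_gen v : P v -> in_span v.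

Definition span : {pred V} := fun v => `[< in_span v >].

Lemma spanP v : reflect (in_span v) (v \in span).
Proof. exact: asboolP. Qed.

Fact span_subsemimod : subsemimod_closed span.
Proof.
split; first split.
- by apply/spanP; exact: in_span0.
- by move=> u v /spanP su /spanP sv; apply/spanP; exact: in_spanD.
- by move=> a v /spanP sv; apply/spanP; exact: in_spanZ.
Qed.

HB.instance Definition _ := GRing.isSubmodClosed.Build K V span span_subsemimod.
End Span.

(* [lquot P] is the quotient vector space V / span(P).  The operations are    *)
(* locked so that unification never unfolds them.                             *)
Definition lquot (K : fieldType) (V : lmodType K) (P : V -> Prop) : Type :=
  @Quotient.quot V (span P).

HB.lock Definition lproj (K : fieldType) (V : lmodType K) (P : V -> Prop)
  (v : V) : lquot P := \pi_(@Quotient.quot V (span P)) v.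
HB.lock Definition lrepr (K : fieldType) (V : lmodType K) (P : V -> Prop)
  (q : lquot P) : V := repr (q : @Quotient.quot V (span P)).
HB.lock Definition lquot_add (K : fieldType) (V : lmodType K) (P : V -> Prop)
  (q r : lquot P) : lquot P := lproj P (lrepr q + lrepr r).
HB.lock Definition lquot_scale (K : fieldType) (V : lmodType K) (P : V -> Prop)
  (a : K) (q : lquot P) : lquot P := lproj P (a *: lrepr q).

HB.instance Definition _ (K : fieldType) (V : lmodType K) (P : V -> Prop) :=
  Choice.copy (lquot P) (@Quotient.quot V (span P)).

Section LinearQuotientTheory.
Variables (K : fieldType) (V : lmodType K) (P : V -> Prop).
Local Notation lquot := (lquot P).
Local Notation lproj := (lproj P).
Local Notation lrepr := (@lrepr K V P).
Local Notation lquot_add := (@lquot_add K V P).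
Local Notation lquot_scale := (@lquot_scale K V P).

Lemma lreprK : cancel lrepr lproj.
Proof. by move=> q; rewrite lproj.unlock lrepr.unlock reprK. Qed.

Lemma lproj_eq u v : (lproj u == lproj v) = (u - v \in span P).
Proof. by rewrite lproj.unlock Quotient.idealrBE. Qed.

Lemma lrepr_proj v : lrepr (lproj v) - v \in span P.
Proof. by rewrite -lproj_eq lreprK. Qed.

Fact lproj_add u v : lproj (u + v) = lquot_add (lproj u) (lproj v).
Proof.
rewrite lquot_add.unlock; apply/eqP; rewrite eq_sym lproj_eq opprD addrACA.
by rewrite rpredD ?lrepr_proj.
Qed.

Fact lproj_scale a v : lproj (a *: v) = lquot_scale a (lproj v).
Proof.
rewrite lquot_scale.unlock; apply/eqP.
by rewrite eq_sym lproj_eq -scalerBr rpredZ ?lrepr_proj.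
Qed.

Fact lquot_addA : associative lquot_add.
Proof.
move=> p q r; rewrite -(lreprK p) -(lreprK q) -(lreprK r).
by rewrite -!lproj_add addrA.
Qed.

Fact lquot_addC : commutative lquot_add.
Proof.
by move=> p q; rewrite -(lreprK p) -(lreprK q) -!lproj_add addrC.
Qed.

Fact lquot_add0 : left_id (lproj 0) lquot_add.
Proof. by move=> q; rewrite -(lreprK q) -lproj_add add0r. Qed.

Fact lquot_addN :
  left_inverse (lproj 0) (fun q => lquot_scale (-1) q) lquot_add.
Proof.
move=> q; rewrite -(lreprK q) -lproj_scale -lproj_add.
by rewrite scaleN1r addNr.
Qed.

HB.instance Definition _ := GRing.isZmodule.Build lquot
  lquot_addA lquot_addC lquot_add0 lquot_addN.

Fact lquot_scaleA a b q :
  lquot_scale a (lquot_scale b q) = lquot_scale (a * b) q.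
Proof. by rewrite -(lreprK q) -!lproj_scale scalerA. Qed.

Fact lquot_scale1 : left_id 1 lquot_scale.
Proof. by move=> q; rewrite -(lreprK q) -lproj_scale scale1r. Qed.

Fact lquot_scaleDr : right_distributive lquot_scale +%R.
Proof.
move=> a q r; rewrite -(lreprK q) -(lreprK r).
have addE s t : s + t = lquot_add s t by [].
by rewrite !addE -lproj_add -!lproj_scale -lproj_add scalerDr.
Qed.

Fact lquot_scaleDl q : {morph lquot_scale^~ q : a b / a + b}.
Proof.
move=> a b; rewrite -(lreprK q).
have addE s t : s + t = lquot_add s t by [].
by rewrite addE -!lproj_scale -lproj_add scalerDl.
Qed.

HB.instance Definition _ := GRing.Zmodule_isLmodule.Build K lquot
  lquot_scaleA lquot_scale1 lquot_scaleDr lquot_scaleDl.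

Fact lproj_linear : linear lproj.
Proof. by move=> a u v; rewrite lproj_add lproj_scale. Qed.

HB.instance Definition _ := GRing.isLinear.Build K V lquot *:%R lproj lproj_linear.

Lemma lproj0P v : reflect (in_span P v) (lproj v == 0).
Proof. by rewrite -(linear0 lproj) lproj_eq subr0; exact: spanP. Qed.

Lemma lproj_gen v : P v -> lproj v = 0.
Proof. by move=> Pv; apply/eqP/lproj0P; exact: in_span_gen. Qed.

Lemma lproj_surj q : exists v, q = lproj v.
Proof. by exists (lrepr q); rewrite lreprK. Qed.

Section Lift.
Variables (W : lmodType K) (f : {linear V -> W}).
Hypothesis fP : forall v, P v -> f v = 0.

Definition lquot_lift (q : lquot) : W := f (lrepr q).

Lemma lin_span0 v : in_span P v -> f v = 0.
Proof.
elim=> [|u w _ fu _ fw|a w _ fw|w /fP //]; first exact: linear0.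
- by rewrite linearD fu fw addr0.
- by rewrite linearZ /= fw scaler0.
Qed.

Lemma lquot_liftE v : lquot_lift (lproj v) = f v.
Proof.
apply/eqP; rewrite -subr_eq0 -linearB; apply/eqP/lin_span0/spanP.
by rewrite -lproj_eq lreprK.
Qed.

Lemma lquot_lift_linear : linear lquot_lift.
Proof.
move=> a q r; have [u ->] := lproj_surj q; have [v ->] := lproj_surj r.
by rewrite -linearP !lquot_liftE linearP.
Qed.
End Lift.
End LinearQuotientTheory.

(* The vector space with basis G is {malg K[G]}; [mlin f] is the linear      *)
(* extension of f : G -> W, and [mprod op] the bilinear extension of a        *)
(* binary operation on G.                                                     *)
Section LinearExtension.
Variables (K : fieldType) (G : choiceType).

Definition mlin (W : lmodType K) (f : G -> W) (u : {malg K[G]}) : W :=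
  \sum_(g <- msupp u) u@_g *: f g.
End LinearExtension.

HB.lock Definition mprod (K : fieldType) (G : choiceType) (op : G -> G -> G)
  (u v : {malg K[G]}) : {malg K[G]} :=
  mlin (fun a => mlin (fun b => << op a b >>) v) u.

Section LinearExtensionTheory.
Variables (K : fieldType) (G : choiceType).

Section Theory.
Variables (W : lmodType K) (f : G -> W).

Lemma mlinEw (d : {fset G}) u : (msupp u `<=` d)%fset ->
  mlin f u = \sum_(g <- d) u@_g *: f g.
Proof.
move=> le_d; rewrite /mlin; apply: (big_fset_incl _ le_d) => g _.
by move=> /mcoeff_outdom ->; rewrite scale0r.
Qed.

Fact mlin_linear : linear (mlin f).
Proof.
move=> a u v; pose d := (msupp u `|` msupp v)%fset.
have du : (msupp u `<=` d)%fset by exact: fsubsetUl.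
have dv : (msupp v `<=` d)%fset by exact: fsubsetUr.
have dw : (msupp (a *: u + v) `<=` d)%fset.
  apply: fsubset_trans (msuppD_le _ _) _; apply: fsetSU; exact: msuppZ_le.
rewrite (mlinEw du) (mlinEw dv) (mlinEw dw) scaler_sumr -big_split.
by apply: eq_bigr => g _; rewrite mcoeffD mcoeffZ scalerDl scalerA.
Qed.

HB.instance Definition _ :=
  GRing.isLinear.Build K {malg K[G]} W *:%R (mlin f) mlin_linear.

Lemma mlinU g : mlin f << g >> = f g.
Proof.
by rewrite (mlinEw (d := [fset g]%fset)) ?msuppU_le // big_seq_fset1 mcoeffUU scale1r.
Qed.
End Theory.

Lemma malg_ind (P : {malg K[G]} -> Prop) :
  P 0 -> (forall a g u, P u -> P (a *: << g >> + u)) -> forall u, P u.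
Proof.
move=> P0 PS u; rewrite [u]monalgE.
elim: (enum_fset _) => [|g s IH]; first by rewrite big_nil.
rewrite big_cons; have -> : << u@_g *g g >> = u@_g *: << g >> :> {malg K[G]}.
  by apply/malgP => k; rewrite mcoeffZ !mcoeffU mulrnAr mulr1.
exact: PS.
Qed.

Lemma malg_linP (W : lmodType K) (f g : {linear {malg K[G]} -> W}) :
  (forall x, f << x >> = g << x >>) -> f =1 g.
Proof.
move=> fg; apply: malg_ind => [|a x u IH]; first by rewrite !linear0.
by rewrite !linearP /= fg IH.
Qed.

Lemma malg_ext (W : lmodType K) (f g : {malg K[G]} -> W) :
  linear f -> linear g -> (forall x, f << x >> = g << x >>) -> f =1 g.
Proof.
move=> fl gl fg; apply: malg_ind => [|a x u IH]; last by rewrite fl gl fg IH.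
rewrite -[0](addNr (0 : {malg K[G]})) -scaleN1r fl gl.
by rewrite !scaleN1r !addNr.
Qed.

Section Prod.
Variable op : G -> G -> G.
Local Notation "u * v" := (@mprod K G op u v).

Fact mprod_linearl v : linear (fun u => u * v).
Proof. by move=> a u w; rewrite mprod.unlock linearP. Qed.

Fact mprod_linearr u : linear (@mprod K G op u).
Proof.
move=> a v w; rewrite mprod.unlock.
elim/malg_ind: u => [|b x u IH]; first by rewrite !linear0 addr0.
rewrite 4!linearP /= IH !mlinU linearP /=.
by rewrite scalerDr; exact: addrACA.
Qed.

Lemma mprodUU x y : << x >> * << y >> = << op x y >>.
Proof. by rewrite mprod.unlock !mlinU. Qed.

Lemma mprodA : associative op -> associative (@mprod K G op).
Proof.
move=> opA u v w.
pose m := @mprod K G op; pose L := mprod_linearl; pose R := mprod_linearr.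
refine (@malg_ext _ (fun u => m u (m v w))
  (fun u => m (m u v) w) _ _ _ u).
- exact: L.
- by move=> a p q; rewrite /m !L.
move=> x.
refine (@malg_ext _ (fun v => m << x >> (m v w))
  (fun v => m (m << x >> v) w) _ _ _ v).
- by move=> a p q; rewrite /m L R.
- by move=> a p q; rewrite /m R L.
move=> y.
refine (@malg_ext _ (fun w => m << x >> (m << y >> w))
  (fun w => m (m << x >> << y >>) w) _ _ _ w).
- by move=> a p q; rewrite /m !R.
- exact: R.
by move=> z; rewrite /m !mprodUU opA.
Qed.
End Prod.
End LinearExtensionTheory.

HB.mixin Record Lmodule_isJordan (K : fieldType) J of GRing.Lmodule K J := {
  jmul : J -> J -> J;
  jmulC : commutative jmul;
  jmul_linearl : forall y, linear (jmul^~ y);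
  jmul_jordan : forall x y,
    jmul (jmul x x) (jmul y x) = jmul (jmul (jmul x x) y) x
}.

#[short(type="jordanType")]
HB.structure Definition Jordan (K : fieldType) :=
  {J of GRing.Lmodule K J & Lmodule_isJordan K J}.

Inductive magma (X : Type) : Type :=
| Leaf of X
| Node of magma X & magma X.

Section MagmaTheory.
Variable X : Type.

Fixpoint leaves (t : magma X) : seq X :=
  match t with
  | Leaf x => [:: x]
  | Node t1 t2 => leaves t1 ++ leaves t2
  end.

Fixpoint meval (J : Type) (op : J -> J -> J) (f : X -> J) (t : magma X) : J :=
  match t with
  | Leaf x => f x
  | Node t1 t2 => op (meval op f t1) (meval op f t2)
  end.

Fixpoint magma_encode (t : magma X) : GenTree.tree X :=
  match t with
  | Leaf x => GenTree.Leaf x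
  | Node t1 t2 => GenTree.Node 0 [:: magma_encode t1; magma_encode t2]
  end.

Fixpoint magma_decode (t : GenTree.tree X) : option (magma X) :=
  match t with
  | GenTree.Leaf x => Some (Leaf x)
  | GenTree.Node _ [:: t1; t2] =>
      if magma_decode t1 is Some u1 then
        if magma_decode t2 is Some u2 then Some (Node u1 u2) else None
      else None
  | _ => None
  end.

Lemma magma_encodeK : pcancel magma_encode magma_decode.
Proof. by elim=> [//|t1 IH1 t2 IH2] /=; rewrite IH1 IH2. Qed.
End MagmaTheory.

HB.instance Definition _ (X : choiceType) :=
  Choice.copy (magma X) (pcan_type (@magma_encodeK X)).

(* The free Jordan algebra with basis of generators X (i.e. on the vector     *)
(* space with basis X): the free non-associative algebra {malg K[magma X]}    *)
(* modulo its ideal generated by the values of the Jordan identities.         *)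
Section FreeJordan.
Variables (K : fieldType) (X : choiceType).

Definition freeNA : Type := {malg K[magma X]}.
HB.instance Definition _ := GRing.Lmodule.on freeNA.

Definition namul : freeNA -> freeNA -> freeNA := mprod (@Node X).
Local Notation "u ** v" := (namul u v) (at level 40, left associativity).

Inductive jordan_ideal : freeNA -> Prop :=
| jideal_comm u v : jordan_ideal (u ** v - v ** u)
| jideal_jordan u v :
    jordan_ideal ((u ** u) ** (v ** u) - ((u ** u) ** v) ** u)
| jideal0 : jordan_ideal 0
| jidealD u v : jordan_ideal u -> jordan_ideal v -> jordan_ideal (u + v)
| jidealZ a u : jordan_ideal u -> jordan_ideal (a *: u)
| jidealMl u v : jordan_ideal v -> jordan_ideal (u ** v)
| jidealMr u v : jordan_ideal u -> jordan_ideal (u ** v).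

Definition freeJ : Type := lquot jordan_ideal.
HB.instance Definition _ := GRing.Lmodule.on freeJ.

Definition freeJ_proj : freeNA -> freeJ := lproj jordan_ideal.
HB.instance Definition _ := GRing.Linear.on freeJ_proj.

Definition jmonom (t : magma X) : freeJ := freeJ_proj << t >>.
Definition jgen (x : X) : freeJ := jmonom (Leaf x).

End FreeJordan.

HB.lock Definition freeJ_mul (K : fieldType) (X : choiceType)
  (p q : freeJ K X) : freeJ K X := freeJ_proj (namul (lrepr p) (lrepr q)).

Section FreeJordanTheory.
Variables (K : fieldType) (X : choiceType).
Local Notation freeNA := (freeNA K X).
Local Notation freeJ := (freeJ K X).
Local Notation freeJ_mul := (@freeJ_mul K X).
Local Notation freeJ_proj := (@freeJ_proj K X).
Local Notation jordan_ideal := (@jordan_ideal K X).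
Local Notation "u ** v" := (@namul K X u v) (at level 40, left associativity).
Implicit Types (u v w : freeNA) (p q r : freeJ).

Lemma freeJ_projP u v : freeJ_proj u = freeJ_proj v <-> jordan_ideal (u - v).
Proof.
split=> [/eqP|uv]; last first.
  by apply/eqP; rewrite lproj_eq; apply/spanP; exact: in_span_gen.
rewrite lproj_eq => /spanP; elim=> //.
- exact: jideal0.
- by move=> *; exact: jidealD.
- by move=> *; exact: jidealZ.
Qed.

Lemma namulDl u v w : (u + v) ** w = u ** w + v ** w.
Proof. by have := mprod_linearl (@Node X) w 1 u v; rewrite !scale1r. Qed.
Lemma namulDr u v w : w ** (u + v) = w ** u + w ** v.
Proof. by have := mprod_linearr (@Node X) w 1 u v; rewrite !scale1r. Qed.
Lemma namul0l w : 0 ** w = 0.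
Proof. by apply: (addrI (0 ** w)); rewrite -namulDl !addr0. Qed.
Lemma namul0r w : w ** 0 = 0.
Proof. by apply: (addrI (w ** 0)); rewrite -namulDr !addr0. Qed.
Lemma namulZl a u w : (a *: u) ** w = a *: (u ** w).
Proof. exact: (GRing.scalable_linear (mprod_linearl (@Node X) w)). Qed.
Lemma namulNl u w : (- u) ** w = - (u ** w).
Proof. by rewrite -scaleN1r namulZl scaleN1r. Qed.
Lemma namulZr a u w : w ** (a *: u) = a *: (w ** u).
Proof. exact: (GRing.scalable_linear (mprod_linearr (@Node X) w)). Qed.
Lemma namulNr u w : w ** (- u) = - (w ** u).
Proof. by rewrite -scaleN1r namulZr scaleN1r. Qed.

Lemma freeJ_projM u v : freeJ_proj (u ** v) = freeJ_mul (freeJ_proj u) (freeJ_proj v).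
Proof.
rewrite freeJ_mul.unlock; apply/freeJ_projP; set u' := lrepr _; set v' := lrepr _.
have uu' : jordan_ideal (u - u') by apply/freeJ_projP; rewrite /freeJ_proj lreprK.
have vv' : jordan_ideal (v - v') by apply/freeJ_projP; rewrite /freeJ_proj lreprK.
have -> : u ** v - u' ** v' = (u - u') ** v + u' ** (v - v').
  by rewrite namulDl namulDr namulNl namulNr addrA subrK.
by apply: jidealD; [exact: jidealMr | exact: jidealMl].
Qed.

Lemma freeJ_proj_linear : linear freeJ_proj.
Proof. exact: lproj_linear. Qed.

Lemma freeJ_proj_surj p : exists u, p = freeJ_proj u.
Proof. exact: lproj_surj. Qed.

Fact freeJ_mulC : commutative freeJ_mul.
Proof.
move=> p q; have [u ->] := freeJ_proj_surj p; have [v ->] := freeJ_proj_surj q.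
by rewrite -!freeJ_projM; apply/freeJ_projP; exact: jideal_comm.
Qed.

Fact freeJ_mul_linearl q : linear (freeJ_mul^~ q).
Proof.
move=> a p r; have [u ->] := freeJ_proj_surj p; have [v ->] := freeJ_proj_surj q.
have [w ->] := freeJ_proj_surj r.
rewrite -(freeJ_proj_linear a u w) -!freeJ_projM namulDl namulZl.
exact: freeJ_proj_linear.
Qed.

Fact freeJ_mul_jordan p q :
  freeJ_mul (freeJ_mul p p) (freeJ_mul q p) =
  freeJ_mul (freeJ_mul (freeJ_mul p p) q) p.
Proof.
have [u ->] := freeJ_proj_surj p; have [v ->] := freeJ_proj_surj q.
by rewrite -!freeJ_projM; apply/freeJ_projP; exact: jideal_jordan.
Qed.

HB.instance Definition _ := Lmodule_isJordan.Build K freeJ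
  freeJ_mulC freeJ_mul_linearl freeJ_mul_jordan.
Lemma freeJ_projJM : {morph freeJ_proj : u v / namul u v >-> jmul u v}.
Proof. exact: freeJ_projM. Qed.
End FreeJordanTheory.

Section JordanTheory.
Variables (K : fieldType) (J : jordanType K).
Implicit Types x y z : J.

Lemma jmulDl : left_distributive (@jmul K J) +%R.
Proof. by move=> x y z; have := jmul_linearl z 1 x y; rewrite !scale1r. Qed.
Lemma jmulDr : right_distributive (@jmul K J) +%R.
Proof. by move=> x y z; rewrite !(jmulC x) jmulDl. Qed.
Lemma jmul0l : left_zero 0 (@jmul K J).
Proof. by move=> x; apply: (addrI (jmul 0 x)); rewrite -jmulDl !addr0. Qed.
Lemma jmulZl a x y : jmul (a *: x) y = a *: jmul x y.
Proof. by have := jmul_linearl y a x 0; rewrite jmul0l !addr0. Qed.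
Lemma jmulZr a x y : jmul x (a *: y) = a *: jmul x y.
Proof. by rewrite !(jmulC x) jmulZl. Qed.
Lemma jmulNl x y : jmul (- x) y = - jmul x y.
Proof. by rewrite -scaleN1r jmulZl scaleN1r. Qed.
Lemma jmulNr x y : jmul x (- y) = - jmul x y.
Proof. by rewrite !(jmulC x) jmulNl. Qed.
End JordanTheory.

(* [jlift f] is the morphism freeJ K X -> J of Jordan algebras extending      *)
(* f : X -> J.                                                                *)
Section UniversalProperty.
Variables (K : fieldType) (X : choiceType) (J : jordanType K) (f : X -> J).

Definition nalift : freeNA K X -> J := mlin (meval (@jmul K J) f).
HB.instance Definition _ := GRing.Linear.on nalift.

Lemma naliftM u v : nalift (namul u v) = jmul (nalift u) (nalift v).
Proof.
elim/malg_ind: u => [|a t u IHu]; first by rewrite namul0l linear0 jmul0l.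
rewrite namulDl namulZl !linearP /= IHu jmulDl jmulZl; congr (_ *: _ + _).
rewrite /nalift mlinU; elim/malg_ind: v {IHu u} => [|b t' v IHv].
  by rewrite [namul _ _]namul0r !linear0 jmulC jmul0l.
rewrite [namul _ _]namulDr namulZr !linearP /= IHv jmulDr jmulZr.
by rewrite /namul mprodUU !mlinU.
Qed.

Lemma nalift_ideal u : jordan_ideal u -> nalift u = 0.
Proof.
elim=> {u}.
- by move=> u v; rewrite linearB /= !naliftM jmulC subrr.
- by move=> u v; rewrite linearB /= !naliftM jmul_jordan subrr.
- exact: linear0.
- by move=> u v _ u0 _ v0; rewrite linearD /= u0 v0 addr0.
- by move=> a u _ u0; rewrite linearZ /= u0 scaler0.
- by move=> u v _ v0; rewrite naliftM v0 jmulC jmul0l.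
- by move=> u v _ u0; rewrite naliftM u0 jmul0l.
Qed.

Definition jlift : freeJ K X -> J := lquot_lift nalift.

Fact jlift_linear : linear jlift.
Proof. exact/lquot_lift_linear/nalift_ideal. Qed.

HB.instance Definition _ :=
  GRing.isLinear.Build K (freeJ K X) J *:%R jlift jlift_linear.

Lemma jliftE u : jlift (freeJ_proj u) = nalift u.
Proof. exact/lquot_liftE/nalift_ideal. Qed.

Lemma jlift_monom t : jlift (jmonom K t) = meval (@jmul K J) f t.
Proof. by rewrite jliftE /nalift mlinU. Qed.

Lemma jlift_gen x : jlift (jgen K x) = f x.
Proof. exact: jlift_monom. Qed.

Lemma jliftM : {morph jlift : p q / jmul p q >-> jmul p q}.
Proof.
move=> p q; have [u ->] := freeJ_proj_surj p; have [v ->] := freeJ_proj_surj q.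
by rewrite -freeJ_projJM !jliftE naliftM.
Qed.
End UniversalProperty.

Lemma freeJ_ind (K : fieldType) (X : choiceType) (P : freeJ K X -> Prop) :
  P 0 -> (forall a t p, P p -> P (a *: jmonom K t + p)) -> forall p, P p.
Proof.
move=> P0 PS p; have [u ->] := freeJ_proj_surj p.
by elim/malg_ind: u => [|a t u IH]; rewrite ?linear0 // linearP; exact: PS.
Qed.

Lemma jmonom_Node (K : fieldType) (X : choiceType) (t1 t2 : magma X) :
  jmonom K (Node t1 t2) = jmul (jmonom K t1) (jmonom K t2).
Proof. by rewrite /jmonom -freeJ_projJM /namul mprodUU. Qed.

Lemma jmorph_eq (K : fieldType) (X : choiceType) (J : jordanType K)
    (f g : {linear freeJ K X -> J}) :
    {morph f : p q / jmul p q >-> jmul p q} ->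
    {morph g : p q / jmul p q >-> jmul p q} ->
  (forall x, f (jgen K x) = g (jgen K x)) -> f =1 g.
Proof.
move=> fM gM fg; elim/freeJ_ind => [|a t p IH]; first by rewrite !linear0.
rewrite !linearP /= {}IH; congr (_ *: _ + _).
elim: t => [x|t1 IH1 t2 IH2]; first exact: fg.
by rewrite jmonom_Node fM gM IH1 IH2.
Qed.

(* The product x o y = (xy + yx) / 2 attached to a bilinear associative       *)
(* product makes any vector space a Jordan algebra.                           *)
Section SpecialProduct.
Variables (K : fieldType) (A : lmodType K) (m : A -> A -> A).
Hypotheses (mA : associative m) (ml : forall v, linear (m^~ v)).
Hypothesis mr : forall u, linear (m u).

Definition sjmul (u v : A) : A := 2%:R^-1 *: (m u v + m v u).

Let mDl u v w : m (u + v) w = m u w + m v w.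
Proof. by have := ml w 1 u v; rewrite !scale1r. Qed.
Let mDr u v w : m w (u + v) = m w u + m w v.
Proof. by have := mr w 1 u v; rewrite !scale1r. Qed.
Let mZl a u w : m (a *: u) w = a *: m u w.
Proof. exact: (GRing.scalable_linear (ml w)). Qed.
Let mZr a u w : m w (a *: u) = a *: m w u.
Proof. exact: (GRing.scalable_linear (mr w)). Qed.

Fact sjmulC : commutative sjmul.
Proof. by move=> u v; rewrite /sjmul addrC. Qed.

Fact sjmul_linearl v : linear (sjmul^~ v).
Proof.
move=> a u w; rewrite /sjmul mDl mDr mZl mZr addrACA -(scalerDr a).
by rewrite (scalerDr _ (a *: _)) !scalerA mulrC.
Qed.

Fact sjmul_jordan u v :
  sjmul (sjmul u u) (sjmul v u) = sjmul (sjmul (sjmul u u) v) u.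
Proof.
rewrite /sjmul; set h := 2%:R^-1; set s := h *: (m u u + m u u).
have su : m s u = m u s by rewrite /s mZl mZr mDl mDr mA.
clearbody s; rewrite !mZl !mZr -!scalerDr; congr (_ *: (_ *: _)).
rewrite !mDl !mDr !mA su -(mA v u s) -su mA.
exact: addrACA.
Qed.
End SpecialProduct.

(* The free non-unital associative algebra T(V) on the vector space with      *)
(* basis X, with basis the non-empty words: (x, s) is the word x :: s.         *)
Definition word (X : choiceType) : Type := (X * seq X)%type.
HB.instance Definition _ (X : choiceType) := Choice.on (word X).

Definition wcat (X : choiceType) (w1 w2 : word X) : word X :=
  (w1.1, w1.2 ++ w2.1 :: w2.2).

Lemma wcatA (X : choiceType) : associative (@wcat X).
Proof. by move=> [x s] [y t] [z r]; rewrite /wcat /= -catA. Qed.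

Definition tensor (K : fieldType) (X : choiceType) : Type := {malg K[word X]}.

Section SpecialJordan.
Variables (K : fieldType) (X : choiceType).
Local Notation tensor := (tensor K X).

HB.instance Definition _ := GRing.Lmodule.on tensor.

Definition tmul : tensor -> tensor -> tensor := mprod (@wcat X).
Definition tgen (x : X) : tensor := << (x, [::]) >>.

Fact tmulA : associative tmul.
Proof. exact/mprodA/wcatA. Qed.
Fact tmul_linearl v : linear (tmul^~ v).
Proof. exact: mprod_linearl. Qed.
Fact tmul_linearr u : linear (tmul u).
Proof. exact: mprod_linearr. Qed.

HB.instance Definition _ := Lmodule_isJordan.Build K tensor
  (sjmulC tmul) (sjmul_linearl tmul_linearl tmul_linearr)
  (sjmul_jordan tmulA tmul_linearl tmul_linearr).

(* SJ(V): the Jordan subalgebra of T(V) generated by V. *)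
Inductive in_SJ : tensor -> Prop :=
| in_SJ_gen x : in_SJ (tgen x)
| in_SJ0 : in_SJ 0
| in_SJD u v : in_SJ u -> in_SJ v -> in_SJ (u + v)
| in_SJZ a u : in_SJ u -> in_SJ (a *: u)
| in_SJM u v : in_SJ u -> in_SJ v -> in_SJ (jmul u v).

Definition SJpred : {pred tensor} := fun u => `[< in_SJ u >].

Lemma SJpredP u : reflect (in_SJ u) (u \in SJpred).
Proof. exact: asboolP. Qed.

Fact SJpred_subsemimod : subsemimod_closed SJpred.
Proof.
split; first split.
- by apply/SJpredP; exact: in_SJ0.
- by move=> u v /SJpredP su /SJpredP sv; apply/SJpredP; exact: in_SJD.
- by move=> a v /SJpredP sv; apply/SJpredP; exact: in_SJZ.
Qed.

HB.instance Definition _ :=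
  GRing.isSubmodClosed.Build K tensor SJpred SJpred_subsemimod.

Definition SJ : Type := {u : tensor | u \in SJpred}.
HB.instance Definition _ := SubChoice.on SJ.
HB.instance Definition _ := [SubChoice_isSubLmodule of SJ by <:].

Fact SJ_mul_subproof (u v : SJ) : jmul (val u) (val v) \in SJpred.
Proof. by apply/SJpredP/in_SJM; apply/SJpredP/valP. Qed.

Definition SJ_mul (u v : SJ) : SJ :=
  exist _ (jmul (val u) (val v)) (SJ_mul_subproof u v).

Fact SJ_mulC : commutative SJ_mul.
Proof. by move=> u v; apply/val_inj; exact: jmulC. Qed.

Fact SJ_mul_linearl v : linear (SJ_mul^~ v).
Proof. by move=> a u w; apply/val_inj; exact: jmul_linearl. Qed.

Fact SJ_mul_jordan u v :
  SJ_mul (SJ_mul u u) (SJ_mul v u) = SJ_mul (SJ_mul (SJ_mul u u) v) u.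
Proof. by apply/val_inj; exact: jmul_jordan. Qed.

HB.instance Definition _ := Lmodule_isJordan.Build K SJ
  SJ_mulC SJ_mul_linearl SJ_mul_jordan.

Fact SJ_gen_subproof x : tgen x \in SJpred.
Proof. exact/SJpredP/in_SJ_gen. Qed.

Definition SJ_gen (x : X) : SJ := exist _ (tgen x) (SJ_gen_subproof x).

(* The natural surjection J(V) -> SJ(V), identity on V. *)
Definition J_to_SJ : freeJ K X -> SJ := jlift SJ_gen.
HB.instance Definition _ := GRing.Linear.on J_to_SJ.

Lemma J_to_SJ_surj v : exists p, J_to_SJ p = v.
Proof.
suff surj u : in_SJ u -> exists p, val (J_to_SJ p) = u.
  have [p pv] := surj _ (SJpredP _ (valP v)); exists p; exact: val_inj.
elim=> {u} [x||u w _ [p <-] _ [q <-]|a u _ [p <-]|u w _ [p <-] _ [q <-]].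
- by exists (jgen K x); rewrite [J_to_SJ _]jlift_gen.
- by exists 0; rewrite [J_to_SJ _]linear0.
- by exists (p + q); rewrite [J_to_SJ _]linearD.
- by exists (a *: p); rewrite [J_to_SJ _]linearZ.
- by exists (jmul p q); rewrite [J_to_SJ _]jliftM.
Qed.
End SpecialJordan.

(* Lambda^2 A, as the vector space on pairs (a, b) modulo bilinearity and     *)
(* a /\ a = 0, and B A = Lambda^2 A / span {a /\ a^2}.                         *)
Section Wedge.
Variables (K : fieldType) (A : lmodType K).

Inductive wedge_rel : {malg K[(A * A)%type]} -> Prop :=
| wedge_rel_l a x y z :
    wedge_rel (<< (a *: x + y, z) >> - (a *: << (x, z) >> + << (y, z) >>))
| wedge_rel_r a x y z :
    wedge_rel (<< (z, a *: x + y) >> - (a *: << (z, x) >> + << (z, y) >>))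
| wedge_rel_alt x : wedge_rel << (x, x) >>.

Definition ext2 : Type := lquot wedge_rel.
HB.instance Definition _ := GRing.Lmodule.on ext2.

End Wedge.

HB.lock Definition wedge (K : fieldType) (A : lmodType K) (x y : A) : ext2 A :=
  lproj (@wedge_rel K A) << (x, y) >>.

Section WedgeTheory.
Variables (K : fieldType) (A : lmodType K).
Local Notation wedge := (@wedge K A).

Lemma wedge_linearl z : linear (wedge^~ z).
Proof.
move=> a x y; rewrite wedge.unlock; apply/eqP; rewrite -subr_eq0 -linearP -linearB.
by apply/eqP/lproj_gen/wedge_rel_l.
Qed.

Lemma wedge_linearr z : linear (wedge z).
Proof.
move=> a x y; rewrite wedge.unlock; apply/eqP; rewrite -subr_eq0 -linearP -linearB.
by apply/eqP/lproj_gen/wedge_rel_r.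
Qed.

Lemma wedgexx x : wedge x x = 0.
Proof. by rewrite wedge.unlock; exact/lproj_gen/wedge_rel_alt. Qed.
End WedgeTheory.

Section JordanB.
Variables (K : fieldType) (A : jordanType K).

Definition B_rel (w : ext2 A) : Prop := exists a : A, w = wedge a (jmul a a).

Definition BJ : Type := lquot B_rel.
HB.instance Definition _ := GRing.Lmodule.on BJ.

End JordanB.

HB.lock Definition bracket (K : fieldType) (A : jordanType K) (a b : A) : BJ A :=
  lproj (@B_rel K A) (wedge a b).

Section JordanBTheory.
Variables (K : fieldType) (A : jordanType K).
Local Notation bracket := (@bracket K A).

Lemma bracketE x y : bracket x y = lproj (@B_rel K A) (wedge x y).
Proof. by rewrite bracket.unlock. Qed.

Lemma bracket_linearl z : linear (bracket^~ z).
Proof. by move=> a x y; rewrite !bracketE wedge_linearl linearP. Qed.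

Lemma bracket_linearr z : linear (bracket z).
Proof. by move=> a x y; rewrite !bracketE wedge_linearr linearP. Qed.

Lemma bracketDl x y z : bracket (x + y) z = bracket x z + bracket y z.
Proof. by have := bracket_linearl z 1 x y; rewrite !scale1r. Qed.
Lemma bracketZl a x z : bracket (a *: x) z = a *: bracket x z.
Proof. exact: (GRing.scalable_linear (bracket_linearl z)). Qed.
Lemma bracket0l z : bracket 0 z = 0.
Proof. by have := bracketZl 0 0 z; rewrite !scale0r. Qed.
End JordanBTheory.

Section BFunctor.
Variables (K : fieldType) (A B : jordanType K) (f : {linear A -> B}).
Hypothesis fM : {morph f : x y / jmul x y >-> jmul x y}.

Let f2 : A * A -> BJ B := fun p => bracket (f p.1) (f p.2).

Fact f2_rel v : wedge_rel v -> mlin f2 v = 0.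
Proof.
case=> {v} => [a x y z|a x y z|x].
- rewrite linearB linearP /= !mlinU /f2 /= linearP.
  by apply/eqP; rewrite subr_eq0; apply/eqP; exact: bracket_linearl.
- rewrite linearB linearP /= !mlinU /f2 /= linearP.
  by apply/eqP; rewrite subr_eq0; apply/eqP; exact: bracket_linearr.
- by rewrite mlinU /f2 bracketE wedgexx linear0.
Qed.

Let g : ext2 A -> BJ B := lquot_lift (mlin f2).
Let g_linear : linear g. Proof. exact/lquot_lift_linear/f2_rel. Qed.
HB.instance Definition _ := GRing.isLinear.Build K (ext2 A) (BJ B) *:%R g g_linear.

Let gE x y : g (wedge x y) = bracket (f x) (f y).
Proof. by rewrite wedge.unlock [LHS]lquot_liftE; [exact: mlinU | exact: f2_rel]. Qed.

Fact g_rel w : B_rel w -> g w = 0.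
Proof.
case=> a ->; rewrite gE fM bracketE; apply: lproj_gen.
by exists (f a).
Qed.

Definition BJ_map : BJ A -> BJ B := lquot_lift g.

Lemma BJ_map_linear : linear BJ_map.
Proof. exact/lquot_lift_linear/g_rel. Qed.

Lemma BJ_mapE x y : BJ_map (bracket x y) = bracket (f x) (f y).
Proof. by rewrite bracketE [LHS]lquot_liftE; [exact: gE | exact: g_rel]. Qed.

Lemma BJ_map_sum0 (I : finType) (x y : I -> A) :
  \sum_i bracket (x i) (y i) = 0 -> \sum_i bracket (f (x i)) (f (y i)) = 0.
Proof.
move=> xy0; have bD p q : BJ_map (p + q) = BJ_map p + BJ_map q.
  by have := BJ_map_linear 1 p q; rewrite !scale1r.
have b0 : BJ_map 0 = 0 by apply: (addrI (BJ_map 0)); rewrite -bD !addr0.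
transitivity (BJ_map (\sum_i bracket (x i) (y i))); last by rewrite xy0.
rewrite (big_morph _ bD b0); apply: eq_bigr => i _.
by rewrite BJ_mapE.
Qed.
End BFunctor.

Section Multilinear.
Variable K : fieldType.

(* The component of J(K^X) of degree one in each generator of S and of degree  *)
(* zero in the others: the grading of J(K^X) is the image of that of the free *)
(* non-associative algebra, hence this component is spanned by the classes of *)
(* the monomials having that multidegree.                                     *)
Definition multilinear (X : finType) (S : {set X}) : {pred freeJ K X} :=
  span (fun p => exists2 t : magma X,
          (forall x, count_mem x (leaves t) = (x \in S)) & p = jmonom K t).
HB.instance Definition _ (X : finType) (S : {set X}) :=
  GRing.SubmodClosed.on (@multilinear X S).

Definition relabel (X Y : Type) (g : X -> Y) : magma X -> magma Y :=
  meval (@Node Y) (@Leaf Y \o g).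

Lemma leaves_relabel (X Y : Type) (g : X -> Y) t :
  leaves (relabel g t) = map g (leaves t).
Proof. by elim: t => //= t1 IH1 t2 IH2; rewrite map_cat -IH1 -IH2. Qed.

Lemma jlift_relabel (X Y : choiceType) (g : X -> Y) t :
  jlift (fun x => jgen K (g x)) (jmonom K t) = jmonom K (relabel g t).
Proof.
rewrite jlift_monom; elim: t => [x //|t1 IH1 t2 IH2].
by rewrite [LHS]/= IH1 IH2; apply/esym; exact: jmonom_Node.
Qed.

Lemma multilinear_lift (X Y : finType) (S : {set X}) (S' : {set Y})
    (f : X -> freeJ K Y) p :
    (forall t, (forall x, count_mem x (leaves t) = (x \in S)) ->
       jlift f (jmonom K t) \in multilinear S') ->
  p \in multilinear S -> jlift f p \in multilinear S'.
Proof.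
move=> fS /spanP; elim=> [|u v _ fu _ fv|a v _ fv|_ [t tS ->]].
- by rewrite linear0 rpred0.
- by rewrite linearD rpredD.
- by rewrite linearZ rpredZ.
- exact: fS.
Qed.

(* The action of permutations of the generators.  As (s * t) x = t (s x) for  *)
(* the product of permutations, [jperm] is a right action for it.             *)
Definition jperm (X : finType) (s : {perm X}) : freeJ K X -> freeJ K X :=
  jlift (fun x => jgen K (s x)).
HB.instance Definition _ (X : finType) (s : {perm X}) :=
  GRing.Linear.on (@jperm X s).

Lemma jperm_multilinear (X : finType) (s : {perm X}) (S : {set X}) p :
  p \in multilinear S -> jperm s p \in multilinear (s @: S).
Proof.
apply: multilinear_lift => t tS; rewrite jlift_relabel.
apply/spanP/in_span_gen; exists (relabel s t) => // x.
rewrite leaves_relabel count_map -[x in RHS](permKV s) mem_imset; last exact: perm_inj.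
by rewrite -tS; apply: eq_count => y /=; rewrite (canF_eq (permK s)).
Qed.
End Multilinear.

Section CyclicStructure.
Variables (K : fieldType) (D : nat).

(* The multilinear part of J(D), with generators x_1, ..., x_D indexed by 'I_D. *)
Definition calJ : Type := {p : freeJ K 'I_D | p \in multilinear [set: 'I_D]}.
HB.instance Definition _ := SubChoice.on calJ.
HB.instance Definition _ := [SubChoice_isSubLmodule of calJ by <:].

Fact calJ_perm_subproof (s : 'S_D) (p : calJ) :
  jperm s (val p) \in multilinear [set: 'I_D].
Proof.
have sT : s @: [set: 'I_D] = [set: 'I_D].
  by apply/setP => x; rewrite inE -(permKV s x) imset_f.
by have := jperm_multilinear s (valP p); rewrite sT.
Qed.

Definition calJ_perm (s : 'S_D) (p : calJ) : calJ :=
  exist _ (jperm s (val p)) (calJ_perm_subproof s p).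

(* SI(D): the kernel of J_to_SJ on the multilinear part of J(D). *)
Definition SIpred : {pred calJ} := fun p => J_to_SJ (val p) == 0.

Fact SIpred_subsemimod : subsemimod_closed SIpred.
Proof.
split; first split.
- by apply/eqP; exact: (linear0 (@J_to_SJ K 'I_D)).
- move=> p q /eqP p0 /eqP q0; apply/eqP.
  transitivity (J_to_SJ (val p) + J_to_SJ (val q)); last by rewrite p0 q0 addr0.
  exact: (linearD (@J_to_SJ K 'I_D)).
- move=> a p /eqP p0; apply/eqP.
  transitivity (a *: J_to_SJ (val p)); last by rewrite p0 scaler0.
  exact: (linearZ_LR (@J_to_SJ K 'I_D)).
Qed.
HB.instance Definition _ :=
  GRing.isSubmodClosed.Build K calJ SIpred SIpred_subsemimod.

Definition SI : Type := {p : calJ | p \in SIpred}.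
HB.instance Definition _ := SubChoice.on SI.
HB.instance Definition _ := [SubChoice_isSubLmodule of SI by <:].

(* X_J(D+1).  K^{1+D} has basis x_0, ..., x_D, indexed by 'I_D.+1, so that   *)
(* an element \sum_i u_i (x) x_i of J(K^{1+D}) (x) K^{1+D} is a family         *)
(* u : {ffun 'I_D.+1 -> freeJ K 'I_D.+1}; it has degree one in each of        *)
(* x_0, ..., x_D when each u_i is multilinear in the x_j with j != i.         *)
Definition XJpred : {pred {ffun 'I_D.+1 -> freeJ K 'I_D.+1}} := fun u =>
  [forall i, u i \in multilinear [set~ i]] &&
  (\sum_i bracket (u i) (jgen K i) == 0).

Fact XJpred_subsemimod : subsemimod_closed XJpred.
Proof.
split; first split.
- apply/andP; split; first by apply/forallP => i; rewrite ffunE rpred0.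
  by rewrite big1 // => i _; rewrite ffunE; exact: bracket0l.
- move=> u v /andP[/forallP uM /eqP u0] /andP[/forallP vM /eqP v0].
  apply/andP; split; first by apply/forallP => i; rewrite ffunE rpredD.
  under eq_bigr => i _ do rewrite ffunE bracketDl.
  by rewrite big_split /= u0 v0 addr0.
- move=> a u /andP[/forallP uM /eqP u0].
  apply/andP; split; first by apply/forallP => i; rewrite ffunE rpredZ.
  under eq_bigr => i _ do rewrite ffunE bracketZl.
  by rewrite -scaler_sumr u0 scaler0.
Qed.
HB.instance Definition _ :=
  GRing.isSubmodClosed.Build K {ffun 'I_D.+1 -> freeJ K 'I_D.+1}
    XJpred XJpred_subsemimod.

Definition XJ : Type :=
  {u : {ffun 'I_D.+1 -> freeJ K 'I_D.+1} | u \in XJpred}.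
HB.instance Definition _ := SubChoice.on XJ.
HB.instance Definition _ := [SubChoice_isSubLmodule of XJ by <:].

(* The permutation s sends u_i (x) x_i to s(u_i) (x) x_{s(i)}. *)
Definition XJ_perm_fun (s : 'S_D.+1) (u : XJ) :
    {ffun 'I_D.+1 -> freeJ K 'I_D.+1} :=
  [ffun i => jperm s (val u ((s^-1)%g i))].

Fact XJ_perm_subproof s u : XJ_perm_fun s u \in XJpred.
Proof.
have /andP[/forallP uM /eqP u0] := valP u.
apply/andP; split.
  apply/forallP => i; rewrite ffunE.
  have -> : [set~ i] = s @: [set~ (s^-1)%g i]; last exact/jperm_multilinear/uM.
  apply/setP => x; rewrite -(permKV s x) mem_imset ?inE ?permKV; last exact: perm_inj.
  by rewrite (inj_eq perm_inj).
rewrite (reindex_inj (@perm_inj _ s)) /=.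
under eq_bigr => i _ do rewrite ffunE permK.
have sM : {morph jperm s : p q / jmul p q >-> jmul (p : freeJ K 'I_D.+1) q}.
  exact: jliftM.
have sg i : jgen K (s i) = jperm s (jgen K i) by rewrite [RHS]jlift_gen.
under eq_bigr => i _ do rewrite sg.
exact/eqP/(BJ_map_sum0 sM).
Qed.

Definition XJ_perm (s : 'S_D.+1) (u : XJ) : XJ :=
  exist _ (XJ_perm_fun s u) (XJ_perm_subproof s u).

(* The projection onto the component J(K^D) (x) x_0: the element u_0 does not *)
(* involve x_0, and [drop_x0] renames its variables x_1, ..., x_D, indexed by *)
(* [lift ord0], into the generators of J(D).                                  *)
Definition drop_x0 : freeJ K 'I_D.+1 -> freeJ K 'I_D :=
  jlift (fun i => if unlift ord0 i is Some j then jgen K j else 0).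
HB.instance Definition _ := GRing.Linear.on drop_x0.

Lemma drop_x0_lift t :
  drop_x0 (jmonom K (relabel (lift ord0) t)) = jmonom K t.
Proof.
rewrite /drop_x0 jlift_monom; elim: t => [x|t1 IH1 t2 IH2].
  by rewrite /= liftK.
by rewrite [LHS]/= IH1 IH2; apply/esym; exact: jmonom_Node.
Qed.

Fact cyc_proj_subproof (u : XJ) :
  drop_x0 (val u ord0) \in multilinear [set: 'I_D].
Proof.
have /andP[/forallP/(_ ord0) uM _] := valP u.
move: uM; apply: multilinear_lift => t tS.
have t0 : ord0 \notin leaves t by rewrite -has_pred1 has_count tS !inE eqxx.
have [t' tE] : exists t', t = relabel (lift ord0) t'.
  elim: t t0 {tS} => [i|t1 IH1 t2 IH2] /=.
    rewrite inE => /unlift_some[j -> _]; by exists (Leaf j).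
  rewrite mem_cat negb_or => /andP[/IH1[t1' ->] /IH2[t2' ->]].
  by exists (Node t1' t2').
apply/spanP/in_span_gen; exists t'; last by rewrite tE; exact: drop_x0_lift.
move=> x; have := tS (lift ord0 x); rewrite tE leaves_relabel count_map !inE.
rewrite eq_sym neq_lift => <-; apply: eq_count => y /=.
by rewrite (inj_eq lift_inj).
Qed.

Definition cyc_proj (u : XJ) : calJ :=
  exist _ (drop_x0 (val u ord0)) (cyc_proj_subproof u).

Fact cyc_proj_linear : linear cyc_proj.
Proof.
by move=> a u v; apply/val_inj; rewrite /= !ffunE; exact: linearP.
Qed.
HB.instance Definition _ :=
  GRing.isLinear.Build K XJ calJ *:%R cyc_proj cyc_proj_linear.
End CyclicStructure.

(* Main.v *)
(* Polarizing a /\ a^2 gives {ab, c} = {a, bc} + {b, ac}, which expands       *)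
(* {t, x_0} into brackets {u_i, x_i}: the projection X_J(D+1) -> J(D) is onto. *)
(* For injectivity, let M be the part of J(K^{1+D}) of degree one in x_0.  The *)
(* same relation says that a Jordan derivation d of J(K^D) with values in      *)
(* End(M), with the transposed bimodule structure, yields a linear map         *)
(* {a, m} |-> d(a)(m); the derivations with d_j(x_i) = delta_ij then read off  *)
(* u_j from sum_i {u_i, x_i}.  Finally {a, b} |-> [a, b] maps BJ to T(V), so   *)
(* that the images v_i of the u_i in T(V) satisfy sum_i [v_i, x_i] = 0, i.e.   *)
(* sum_i v_i x_i is invariant under rotation of words; in the multilinear part *)
(* v_0 = 0 thus forces all v_i = 0.  Hence SI(D) corresponds to the families u *)
(* all of whose components are special identities, a stable condition.         *)
From HB Require Import structures.
Require Import Defs.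
From mathcomp Require Import all_boot all_order all_algebra all_fingroup.
From mathcomp Require Import ssrAC monalg boolp.

Set Implicit Arguments.
Unset Strict Implicit.
Unset Printing Implicit Defensive.

Import GRing.Theory.

Local Open Scope ring_scope.

(** An element of X_J(D+1) is a family u with sum_i {u_i, x_i} = 0. Each multilinear u_0 extends to
    such a family ([cyc_proj_surj], from [bracket_monom_expand]), and u_0 determines the family
    ([XJ_component0]). So [cyc_proj] is bijective and carries the action over to J(D). A permutation
    moves some u_i, renamed, into position 0. Stability of SI(D) therefore means: if u_0 dies in
    T(V), so does every u_i ([XJ_special_components]). Uniqueness and this last point share a
    device. An alternating form vanishing on all pairs (a, a^2) may be applied to the relation sum_i
    {u_i, x_i} = 0 ([form_sum0]). A form built from Fox derivatives isolates a single u_i; the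
    commutator of T(V) compares the coefficients of words that differ by a rotation. *)

Section Polarization.

(** * Polarized identities in Jordan algebras and in B A *)

Variables (K : fieldType) (two_neq0 : 2%:R != 0 :> K).

Lemma mulr2n_eq0 (W : lmodType K) (w : W) : w *+ 2 = 0 -> w = 0.
Proof.
move=> w2; apply/eqP; move: (scaler_eq0 2%:R w).
by rewrite scaler_nat w2 eqxx (negbTE two_neq0) /= => <-.
Qed.

(** Expanding c on the diagonal at a + b leaves [p a b], quadratic in a and linear in b, plus
    [p b a]. Changing the sign of z negates only one of the two terms, so each vanishes after
    division by 2. *)
Lemma cubic_polar (V W : lmodType K) (c : V -> V -> V -> W) :
    (forall y z, {morph (fun x => c x y z) : a b / a + b}) ->
    (forall x y, {morph c x y : a b / a + b}) ->
    (forall x y z, c x y z = c y x z) -> (forall x, c x x x = 0) ->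
  forall x z, c x x z + c x z x *+ 2 = 0.
Proof.
move=> c1 c3 cC cxxx x z.
have c2 x' z' : {morph (fun y => c x' y z') : a b / a + b}.
  by move=> a b; rewrite cC c1 !(cC _ x').
have c3N x' y' a : c x' y' (- a) = - c x' y' a.
  apply: (addrI (c x' y' a)); rewrite -c3 !subrr.
  by apply: (addrI (c x' y' 0)); rewrite -c3 !addr0.
have c2N x' y' a : c x' (- a) y' = - c x' a y'.
  apply: (addrI (c x' a y')); rewrite -c2 !subrr.
  by apply: (addrI (c x' 0 y')); rewrite -c2 !addr0.
pose p a b := c a a b + c a b a *+ 2.
have E a b : p a b + p b a = 0.
  have := cxxx (a + b); rewrite c1 !c2 !c3 !cxxx /p !(cC b a) add0r addr0 => <-.
  rewrite !mulr2n; move: (c a a b) (c a b a) (c b b a) (c a b b) => x1 x2 x3 x4.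
  by rewrite [RHS](AC ((1*2)*3) ((1*(2*4))*(6*(3*5)))).
have pNr : p x (- z) = - p x z by rewrite /p c3N c2N mulNrn -opprD.
have pNl : p (- z) x = p z x.
  by rewrite /p c2N c3N (cC _ z) c2N (cC (- z)) c2N (cC x) !opprK.
have pC : p z x = - p x z by apply/eqP; rewrite -addr_eq0 addrC E.
have := E x (- z); rewrite pNr pNl pC -opprD -mulr2n => /eqP.
by rewrite oppr_eq0 => /eqP/mulr2n_eq0.
Qed.

(** For fixed y the Jordan identity is cubic in x; this is its part linear in z. *)
Lemma jordan_polar (J : jordanType K) (x y z : J) :
  jmul (jmul x x) (jmul y z) + jmul (jmul x z) (jmul y x) *+ 2 =
  jmul (jmul (jmul x x) y) z + jmul (jmul (jmul x z) y) x *+ 2.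
Proof.
pose c (u v w : J) := jmul (jmul u v) (jmul y w) - jmul (jmul (jmul u v) y) w.
suff: c x x z + c x z x *+ 2 = 0.
  rewrite /c mulrnBl addrACA -opprD => /eqP; rewrite subr_eq0 => /eqP //.
apply: cubic_polar => [v w a b|u v a b|u v w|u]; rewrite /c.
- by rewrite !jmulDl opprD addrACA.
- by rewrite !jmulDr opprD addrACA.
- by rewrite (jmulC u).
- by rewrite jmul_jordan subrr.
Qed.

Lemma bracketxx (A : jordanType K) (x : A) : bracket x x = 0.
Proof. by rewrite bracketE wedgexx linear0. Qed.

Lemma bracketDr (A : jordanType K) (x y z : A) :
  bracket x (y + z) = bracket x y + bracket x z.
Proof. by have := bracket_linearr x 1 y z; rewrite !scale1r. Qed.

Lemma bracketC (A : jordanType K) (x y : A) : bracket x y = - bracket y x.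
Proof.
apply/eqP; rewrite -addr_eq0; apply/eqP.
by have := bracketxx (x + y); rewrite bracketDl !bracketDr !bracketxx
  add0r addr0.
Qed.

(** Full polarization of {w, w^2} = 0, with one bracket turned around. It moves factors out of the
    left entry and drives the expansion behind surjectivity. *)
Lemma bracketMl (A : jordanType K) (x y z : A) :
  bracket (jmul x y) z = bracket x (jmul y z) + bracket y (jmul x z).
Proof.
pose c (u v w : A) := bracket w (jmul u v).
have cC u v w : c u v w = c v u w by rewrite /c jmulC.
have cP u v : c u u v + c u v u *+ 2 = 0.
  apply: cubic_polar => [v' w a b|u' v' a b|//|w]; rewrite /c.
  - by rewrite jmulDl bracketDr.
  - by rewrite bracketDl.
  by rewrite bracketE lproj_gen //; exists w.
suff: c x y z + (c y z x + c x z y) = 0.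
  by move=> /eqP; rewrite addrC addr_eq0 /c (bracketC z) opprK eq_sym => /eqP.
apply: mulr2n_eq0; have := cP (x + y) z.
have -> : c (x + y) (x + y) z = c x x z + c y y z + c x y z *+ 2.
  rewrite /c jmulDl !jmulDr !bracketDr (jmulC y x) mulr2n.
  by rewrite [LHS](AC (2*2) ((1*4)*(2*3))).
have -> : c (x + y) z (x + y) = c x z x + c y z y + (c y z x + c x z y).
  by rewrite /c bracketDl jmulDl !bracketDr [LHS](AC (2*2) ((1*4)*(2*3))).
rewrite mulrnDl addrACA mulrnDl [X in X + _]addrACA !cP addr0 add0r.
by rewrite -mulrnDl.
Qed.
End Polarization.

Section LinearFun.
Variables (K : fieldType) (V W : lmodType K) (f : V -> W) (fl : linear f).

Lemma linear_funD : {morph f : x y / x + y}.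
Proof. by move=> x y; have := fl 1 x y; rewrite !scale1r. Qed.

Lemma linear_fun0 : f 0 = 0.
Proof. by apply: (addrI (f 0)); rewrite -linear_funD !addr0. Qed.
End LinearFun.

Lemma jmul0r (K : fieldType) (J : jordanType K) : right_zero 0 (@jmul K J).
Proof. by move=> x; rewrite jmulC jmul0l. Qed.

(** * Alternating forms that factor through B A *)

Section AlternatingForms.
Variables (K : fieldType) (A : jordanType K) (W : lmodType K).
Variable w : A -> A -> W.
Hypothesis wl : forall z, linear (w^~ z).
Hypothesis wr : forall z, linear (w z).
Hypothesis wxx : forall x, w x x = 0.
Hypothesis wxx2 : forall x, w x (jmul x x) = 0.

Let w2 : A * A -> W := fun p => w p.1 p.2.

Fact form_wedge_rel v : wedge_rel v -> mlin w2 v = 0.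
Proof.
case=> {v} => [a x y z|a x y z|x].
- rewrite linearB linearP /= !mlinU /w2 /=.
  by apply/eqP; rewrite subr_eq0; apply/eqP; exact: wl.
- rewrite linearB linearP /= !mlinU /w2 /=.
  by apply/eqP; rewrite subr_eq0; apply/eqP; exact: wr.
- by rewrite mlinU /w2 wxx.
Qed.

Let g : ext2 A -> W := lquot_lift (mlin w2).
Let g_linear : linear g. Proof. exact/lquot_lift_linear/form_wedge_rel. Qed.
HB.instance Definition _ := GRing.isLinear.Build K (ext2 A) W *:%R g g_linear.

Let gE x y : g (wedge x y) = w x y.
Proof.
by rewrite wedge.unlock [LHS]lquot_liftE; [exact: mlinU | exact: form_wedge_rel].
Qed.

Let g_rel v : B_rel v -> g v = 0.
Proof. by case=> a ->; rewrite gE wxx2. Qed.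

Lemma form_sum0 (I : finType) (x y : I -> A) :
  \sum_i bracket (x i) (y i) = 0 -> \sum_i w (x i) (y i) = 0.
Proof.
under eq_bigr => i _ do rewrite bracketE.
rewrite -linear_sum /= => /eqP/lproj0P/(lin_span0 g_rel).
by rewrite linear_sum /=; under eq_bigr => i _ do rewrite gE.
Qed.
End AlternatingForms.

(** * Fox derivatives of the free Jordan algebra *)

(* [fox p m] is the derivative of p with respect to the generator i, with     *)
(* values in the linear endomorphisms of J(X), evaluated at m.  The bimodule  *)
(* structure is the transpose of the one by left multiplications, which is    *)
(* why the arguments are nested in reverse order in [foxM].                   *)
Section Fox.
Variables (K : fieldType) (two_neq0 : 2%:R != 0 :> K).
Variables (X : choiceType) (i : X).
Local Notation J := (freeJ K X).

Fixpoint fox_monom (t : magma X) (m : J) : J :=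
  match t with
  | Leaf x => if x == i then m else 0
  | Node s t => fox_monom s (jmul (jmonom K t) m) +
                fox_monom t (jmul (jmonom K s) m)
  end.

Fact fox_monom_linear t : linear (fox_monom t).
Proof.
elim: t => [x|s IHs t IHt] a m n /=.
  by case: eqP => // _; rewrite scaler0 addr0.
by rewrite !jmulDr !jmulZr IHs IHt scalerDr addrACA.
Qed.

Definition fox_na (m : J) : freeNA K X -> J := mlin (fox_monom^~ m).
HB.instance Definition _ m := GRing.Linear.on (fox_na m).

Fact fox_na_linear u : linear (fox_na^~ u).
Proof.
move=> a m n; elim/malg_ind: u => [|b t u IH].
  by rewrite !linear0 addr0.
have E x : fox_na x (b *: << t >> + u) = b *: fox_monom t x + fox_na x u.
  by rewrite linearP /= {1}/fox_na mlinU.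
by rewrite !E IH fox_monom_linear !scalerDr !scalerA (mulrC b) addrACA.
Qed.

Fact fox_naM u v m : fox_na m (namul u v) =
  fox_na (jmul (freeJ_proj v) m) u + fox_na (jmul (freeJ_proj u) m) v.
Proof.
have L := fox_na_linear; have N0 x := linear_fun0 (L x).
elim/malg_ind: u => [|a s u IHu].
  by rewrite namul0l !linear0 jmul0l N0 addr0.
rewrite namulDl namulZl !linearP /= IHu jmulDl jmulZl L addrACA -scalerDr.
congr (_ *: _ + _); elim/malg_ind: v {IHu u} => [|b t v IHv].
  by rewrite [namul _ _]namul0r !linear0 jmul0l N0 addr0.
rewrite [namul _ _]namulDr namulZr !linearP /= IHv jmulDl jmulZl L.
rewrite addrACA -scalerDr; congr (_ *: _ + _).
by rewrite /namul mprodUU /fox_na !mlinU.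
Qed.

Fact freeJ_proj_ideal (u : freeNA K X) : jordan_ideal u -> freeJ_proj u = 0.
Proof.
move=> uI; rewrite -(linear0 (@freeJ_proj K X)).
by apply/freeJ_projP; rewrite subr0.
Qed.

(** The transposed bimodule satisfies the Jordan identities. The quantifier on m stays inside the
    induction because differentiating a product multiplies m by the other factor. *)
Fact fox_na_ideal u : jordan_ideal u -> forall m, fox_na m u = 0.
Proof.
have D x m n := linear_funD (fox_na_linear x) m n.
have N0 x := linear_fun0 (fox_na_linear x).
elim=> {u} [u v m|u v m|m|u v _ u0 _ v0 m|a u _ u0 m|u v vI v0 m|u v uI u0 m].
- by rewrite linearB /= !fox_naM [X in _ - X]addrC subrr.
- rewrite linearB /= !(fox_naM, freeJ_projJM).
  set a := freeJ_proj u; set b := freeJ_proj v.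
  have hz := jordan_polar two_neq0 a b m.
  have hy := jordan_polar two_neq0 a m b.
  (* The arguments at which u is differentiated on the two sides agree by [h], those for v by [hv].
     The two polarizations [hz] and [hy] have equal left sides, and [h] equates their right
     sides. *)
  have h : jmul a (jmul (jmul b a) m) *+ 2 + jmul b (jmul (jmul a a) m) =
           jmul a (jmul b (jmul a m)) *+ 2 + jmul (jmul (jmul a a) b) m.
    move: hz hy.
    rewrite (jmulC m b) (jmulC m a) (jmulC (jmul a b)) (jmulC b a).
    move=> -> => /esym.
    rewrite (jmulC (jmul _ _) b) (jmulC (jmul _ m) a) addrC => ->.
    by rewrite [RHS]addrC (jmulC b (jmul a m)) (jmulC a (jmul (jmul a m) b)).
  have hv : jmul a (jmul (jmul a a) m) = jmul (jmul a a) (jmul a m).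
    by rewrite (jmulC a m) jmul_jordan (jmulC a).
  rewrite -!D -!mulr2n [X in X - _]addrCA [X in _ - X]addrAC.
  by rewrite -!D h hv [X in X - _]addrC subrr.
- exact: linear0.
- by rewrite linearD /= u0 v0 addr0.
- by rewrite linearZ /= u0 scaler0.
- by rewrite fox_naM v0 freeJ_proj_ideal // jmul0l N0 addr0.
- by rewrite fox_naM u0 freeJ_proj_ideal // jmul0l N0 addr0.
Qed.

Definition fox (p m : J) : J := lquot_lift (fox_na m) p.

Fact foxE u m : fox (freeJ_proj u) m = fox_na m u.
Proof. by apply: lquot_liftE => v vI; exact: fox_na_ideal. Qed.

Lemma fox_linearl m : linear (fox^~ m).
Proof. by apply: lquot_lift_linear => v vI; exact: fox_na_ideal. Qed.

Lemma fox_linearr p : linear (fox p).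
Proof.
move=> a m n; have [u ->] := freeJ_proj_surj p.
by rewrite !foxE fox_na_linear.
Qed.

Lemma foxM p q m : fox (jmul p q) m = fox p (jmul q m) + fox q (jmul p m).
Proof.
have [u ->] := freeJ_proj_surj p; have [v ->] := freeJ_proj_surj q.
by rewrite -freeJ_projJM !foxE fox_naM.
Qed.

Lemma fox_gen x m : fox (jgen K x) m = if x == i then m else 0.
Proof. by rewrite foxE /fox_na mlinU. Qed.
End Fox.

(** * Components of degree zero and one in a generator *)

(* [deg0] and [deg1] are the projections on the components of degree zero and *)
(* one in the generator i; [deg1] is a derivation over the morphism [deg0].   *)
Section DegreeOne.
Variables (K : fieldType) (two_neq0 : 2%:R != 0 :> K).
Variables (X : choiceType) (i : X).
Local Notation J := (freeJ K X).

Definition deg0 : J -> J := jlift (fun x => if x == i then 0 else jgen K x).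
HB.instance Definition _ := GRing.Linear.on deg0.

Lemma deg0M : {morph deg0 : p q / jmul p q}.
Proof. exact: jliftM. Qed.

Fixpoint deg1_monom (t : magma X) : J :=
  match t with
  | Leaf x => if x == i then jgen K x else 0
  | Node s t => jmul (deg0 (jmonom K t)) (deg1_monom s) +
                jmul (deg0 (jmonom K s)) (deg1_monom t)
  end.

Definition deg1_na : freeNA K X -> J := mlin deg1_monom.
HB.instance Definition _ := GRing.Linear.on deg1_na.

Fact deg1_naM u v : deg1_na (namul u v) =
  jmul (deg0 (freeJ_proj v)) (deg1_na u) +
  jmul (deg0 (freeJ_proj u)) (deg1_na v).
Proof.
elim/malg_ind: u => [|a s u IHu].
  by rewrite namul0l !linear0 jmulC !jmul0l addr0.
rewrite namulDl namulZl !linearP /= IHu.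
rewrite jmulDl jmulZl jmulDr jmulZr addrACA -scalerDr.
congr (_ *: _ + _); elim/malg_ind: v {IHu u} => [|b t v IHv].
  by rewrite [namul _ _]namul0r !linear0 jmul0l jmulC jmul0l addr0.
rewrite [namul _ _]namulDr namulZr !linearP /= IHv.
rewrite jmulDl jmulZl jmulDr jmulZr.
rewrite addrACA -scalerDr; congr (_ *: _ + _).
by rewrite /namul mprodUU /deg1_na !mlinU.
Qed.

Fact deg1_na_ideal u : jordan_ideal u -> deg1_na u = 0.
Proof.
elim=> {u} [u v|u v||u v _ u0 _ v0|a u _ u0|u v vI v0|u v uI u0].
- by rewrite linearB /= !deg1_naM [X in _ - X]addrC subrr.
- rewrite linearB /= !(deg1_naM, freeJ_projJM, deg0M).
  set a := deg0 (freeJ_proj u); set b := deg0 (freeJ_proj v).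
  set m := deg1_na u; set n := deg1_na v.
  have h := jordan_polar two_neq0 a b m.
  have hn : jmul (jmul a a) (jmul a n) = jmul a (jmul (jmul a a) n).
    by rewrite (jmulC a n) jmul_jordan (jmulC a).
  rewrite !jmulDr -!mulr2n (jmulC (jmul b a)).
  rewrite (jmulC a (jmul b _)) (jmulC b (jmul a m)).
  rewrite [X in X - _]addrCA [X in _ - X]addrAC (addrC (_ *+ 2)) h hn.
  by rewrite [X in X - _]addrC (addrC (_ *+ 2)) subrr.
- exact: linear0.
- by rewrite linearD /= u0 v0 addr0.
- by rewrite linearZ /= u0 scaler0.
- rewrite deg1_naM v0 (freeJ_proj_ideal vI) [deg0 0]linear0.
  by rewrite jmul0l jmul0r addr0.
- rewrite deg1_naM u0 (freeJ_proj_ideal uI) [deg0 0]linear0.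
  by rewrite jmul0l jmul0r addr0.
Qed.

Definition deg1 : J -> J := lquot_lift deg1_na.

Lemma deg1_linear : linear deg1.
Proof. exact/lquot_lift_linear/deg1_na_ideal. Qed.

Fact deg1E u : deg1 (freeJ_proj u) = deg1_na u.
Proof. exact/lquot_liftE/deg1_na_ideal. Qed.

Lemma deg1M p q :
  deg1 (jmul p q) = jmul (deg0 q) (deg1 p) + jmul (deg0 p) (deg1 q).
Proof.
have [u ->] := freeJ_proj_surj p; have [v ->] := freeJ_proj_surj q.
by rewrite -freeJ_projJM !deg1E deg1_naM.
Qed.

Lemma deg1_gen x : deg1 (jgen K x) = if x == i then jgen K x else 0.
Proof. by rewrite deg1E /deg1_na mlinU. Qed.

Lemma deg0_monom t :
  deg0 (jmonom K t) = if i \in leaves t then 0 else jmonom K t.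
Proof.
elim: t => [x|s IHs t IHt]; first by rewrite [LHS]jlift_gen inE eq_sym.
rewrite jmonom_Node deg0M IHs IHt /= mem_cat.
by case: (i \in _); rewrite ?jmul0l //; case: (i \in _); rewrite ?jmul0r.
Qed.

Lemma deg1_monom1 t :
  count_mem i (leaves t) = 1%N -> deg1 (jmonom K t) = jmonom K t.
Proof.
elim: t => [x|s IHs t IHt] /=.
  by rewrite addn0 [deg1 _]deg1_gen; case: eqP.
rewrite count_cat jmonom_Node deg1M !deg0_monom -!has_pred1 !has_count.
case: (posnP (count _ (leaves s))) => [s0|s_gt0].
  rewrite s0 add0n => t1; rewrite t1 IHt // jmul0l add0r //.
case: (posnP (count _ (leaves t))) => [t0|t_gt0].
  by rewrite t0 addn0 => s1; rewrite IHs // jmul0l addr0 jmulC.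
move: s_gt0 t_gt0; case: (count _ _) => // a _; case: (count _ _) => // b _.
by rewrite addnS.
Qed.
End DegreeOne.

(** * Bijectivity of the projection onto the x_0 component *)

Section CyclicBijection.
Variables (K : fieldType) (two_neq0 : 2%:R != 0 :> K) (D : nat).
Local Notation J := (freeJ K 'I_D.+1).

Lemma multilinear_monom (X : finType) (S : {set X}) (t : magma X) :
    (forall x, count_mem x (leaves t) = (x \in S)) ->
  jmonom K t \in multilinear S.
Proof. by move=> tS; apply/spanP/in_span_gen; exists t. Qed.

Lemma multilinear_linear_eq (X : finType) (S : {set X}) (W : lmodType K)
    (f g : freeJ K X -> W) :
    linear f -> linear g ->
    (forall t, (forall x, count_mem x (leaves t) = (x \in S)) ->
       f (jmonom K t) = g (jmonom K t)) ->
  {in multilinear S, f =1 g}.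
Proof.
move=> fl gl fg p /spanP; elim=> [|u v _ fu _ fv|a v _ fv|_ [t tS ->]].
- by rewrite (linear_fun0 fl) (linear_fun0 gl).
- by rewrite (linear_funD fl) (linear_funD gl) fu fv.
- by rewrite (GRing.scalable_linear fl) (GRing.scalable_linear gl) /= fv.
- exact: fg.
Qed.

Lemma deg0_multilinear (X : finType) (S : {set X}) (i : X) (p : freeJ K X) :
  i \in S -> p \in multilinear S -> deg0 i p = 0.
Proof.
move=> iS; apply: (multilinear_linear_eq (f := deg0 i) (g := \0)).
- exact: linearP.
- exact: linearP.
by move=> t tS; rewrite deg0_monom -has_pred1 has_count tS iS.
Qed.

Lemma deg1_multilinear (X : finType) (S : {set X}) (i : X) (p : freeJ K X) :
  i \in S -> p \in multilinear S -> deg1 i p = p.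
Proof.
move=> iS; apply: (multilinear_linear_eq (g := id)) => //.
  exact: deg1_linear.
by move=> t tS; rewrite deg1_monom1 // tS iS.
Qed.

(** The pairing (a, m) -> d_j(a)(m) of degree zero with degree one in the generator i, made
    alternating. *)
Definition fox_form (X : choiceType) (i j : X) (a b : freeJ K X) : freeJ K X :=
  fox j (deg0 i a) (deg1 i b) - fox j (deg0 i b) (deg1 i a).

Lemma fox_form_sum0 (X : choiceType) (i j : X) (I : finType)
    (x y : I -> freeJ K X) :
  \sum_k bracket (x k) (y k) = 0 ->
  \sum_k fox_form i j (x k) (y k) = 0.
Proof.
have Ll := fox_linearl two_neq0 j; have Lr := fox_linearr two_neq0 j.
apply: form_sum0 => [z a u v|z a u v|u|u]; rewrite /fox_form.
- by rewrite !linearP deg1_linear // Ll Lr opprD scalerBr addrACA.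
- by rewrite !linearP deg1_linear // Ll Lr opprD scalerBr addrACA.
- exact: subrr.
- rewrite deg1M // deg0M (foxM two_neq0) -(linear_funD (Lr _)).
  by rewrite subrr.
Qed.

(** In [fox_form ord0 i], the term of index k other than 0 is -d_i(x_k)(u_k), since u_k has degree
    one in x_0 and x_k has degree zero. Only -u_i survives, the term of index 0 vanishing with
    u_0. *)
Lemma XJ_component0 (u : XJ K D) (i : 'I_D.+1) :
  val u ord0 = 0 -> val u i = 0.
Proof.
move=> u0; have /andP[/forallP uM /eqP uB] := valP u.
have [->//|i0] := eqVneq i ord0.
have := fox_form_sum0 ord0 i uB; rewrite (bigD1 i) //= big1 => [|j ji].
  rewrite addr0 /fox_form (@deg0_multilinear _ [set~ i]) ?inE 1?eq_sym //.
  rewrite (linear_fun0 (fox_linearl two_neq0 i _)) sub0r.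
  rewrite (@deg1_multilinear _ [set~ i]) ?inE 1?eq_sym //.
  rewrite [deg0 _ _]jlift_gen (negPf i0) (fox_gen two_neq0) eqxx => /eqP.
  by rewrite oppr_eq0 => /eqP.
have [->|j0] := eqVneq j ord0.
  rewrite u0 /fox_form linear0 (linear_fun0 (deg1_linear two_neq0 _)).
  rewrite (linear_fun0 (fox_linearl two_neq0 i _)).
  by rewrite (linear_fun0 (fox_linearr two_neq0 i _)) subr0.
rewrite /fox_form (@deg0_multilinear _ [set~ j]) ?inE 1?eq_sym //.
rewrite (linear_fun0 (fox_linearl two_neq0 i _)) sub0r.
by rewrite [deg0 _ _]jlift_gen (negPf j0) (fox_gen two_neq0) (negPf ji) oppr0.
Qed.

Definition add_x0 : freeJ K 'I_D -> J := jlift (fun j => jgen K (lift ord0 j)).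
HB.instance Definition _ := GRing.Linear.on add_x0.

Lemma drop_x0K : {in multilinear [set~ ord0], cancel (@drop_x0 K D) add_x0}.
Proof.
apply: (multilinear_linear_eq (f := add_x0 \o @drop_x0 K D) (g := id)) => //.
  exact: linearP.
move=> t tS /=.
have t0 : ord0 \notin leaves t by rewrite -has_pred1 has_count tS !inE eqxx.
elim: t t0 {tS} => [x|s IHs t IHt] /=.
  rewrite inE => /unlift_some[j -> _].
  by rewrite [drop_x0 _]jlift_gen liftK [LHS]jlift_gen.
rewrite mem_cat negb_or jmonom_Node => /andP[/IHs {2}<- /IHt {2}<-].
by rewrite [drop_x0 _]jliftM [LHS]jliftM.
Qed.

Lemma cyc_proj_inj : injective (@cyc_proj K D).
Proof.
suff ker0 (u : XJ K D) : cyc_proj u = 0 -> u = 0.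
  move=> u v uv; apply/eqP; rewrite -subr_eq0; apply/eqP/ker0.
  by rewrite linearB /= uv subrr.
move=> /(congr1 val) /= u0; apply/val_inj/ffunP => i; rewrite ffunE.
apply: XJ_component0; have /andP[/forallP uM _] := valP u.
by rewrite -(drop_x0K (uM ord0)) u0 linear0.
Qed.

(** Induction on t for all q, by {rs, q} = {r, sq} + {s, rq}: the left entry shrinks to one
    generator. The support condition keeps position 0 free when x_0 is not in t. *)
Lemma bracket_monom_expand (t q : magma 'I_D.+1) :
    (forall x, count_mem x (leaves t ++ leaves q) = 1%N) ->
  exists w : {ffun 'I_D.+1 -> J},
    [/\ forall i, w i \in multilinear [set~ i],
        forall i, i \notin leaves t -> w i = 0
      & bracket (jmonom K t) (jmonom K q) + \sum_i bracket (w i) (jgen K i) = 0].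
Proof.
elim: t q => [x|s IHs t IHt] q tq.
  have qM : jmonom K q \in multilinear [set~ x].
    apply: multilinear_monom => y; have := tq y; rewrite /= !inE.
    by rewrite eq_sym; case: eqP => _ /= => [[]|].
  exists [ffun i => if i == x then jmonom K q else 0]; split=> [i|i|].
  - by rewrite ffunE; case: eqP => [->|_] //; rewrite rpred0.
  - by rewrite inE ffunE => /negPf ->.
  rewrite (bigD1 x) //= big1 ?addr0 => [|i /negPf ix].
    by rewrite ffunE eqxx [bracket (jmonom _ _) _]bracketC addNr.
  by rewrite ffunE ix bracket0l.
have [|w1 [w1M w10 w1B]] := IHs (Node t q).
  by move=> x; rewrite -(tq x) /= catA.
have [|w2 [w2M w20 w2B]] := IHt (Node s q).
  by move=> x; rewrite -(tq x) /= !count_cat addnCA addnA.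
exists (w1 + w2); split=> [i|i|].
- by rewrite ffunE rpredD.
- by rewrite /= mem_cat negb_or ffunE => /andP[/w10 -> /w20 ->]; rewrite addr0.
under eq_bigr => i _ do rewrite ffunE bracketDl.
rewrite big_split jmonom_Node (bracketMl two_neq0) -!jmonom_Node addrACA.
by rewrite w1B w2B addr0.
Qed.

Lemma cyc_proj_surj (p : calJ K D) : exists u : XJ K D, cyc_proj u = p.
Proof.
suff /(_ _ (valP p)) [u uE] : forall q, q \in multilinear [set: 'I_D] ->
    exists u : XJ K D, val (cyc_proj u) = q.
  by exists u; apply: val_inj.
move=> q /spanP; elim=> {q} [|q r _ [u <-] _ [v <-]|a q _ [u <-]|_ [t tT ->]].
- by exists 0; rewrite linear0.
- by exists (u + v); rewrite linearD.
- by exists (a *: u); rewrite linearZ.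
set t' := relabel (lift ord0) t.
have t'S x : count_mem x (leaves t') = (x \in [set~ ord0]).
  rewrite leaves_relabel count_map !inE.
  rewrite eq_sym; have [<-|/unlift_some[j -> _]] := eqVneq ord0 x.
    rewrite -[RHS](count_pred0 (leaves t)); apply: eq_count => j /=.
    by rewrite eq_sym (negPf (neq_lift _ _)).
  transitivity (count_mem j (leaves t)); last by rewrite tT inE.
    apply: eq_count => k /=.
  by rewrite (inj_eq lift_inj).
have [|w [wM w0 wB]] := @bracket_monom_expand t' (Leaf ord0).
  by move=> x; rewrite count_cat t'S /= !inE addn0 (eq_sym ord0); case: eqP.
have t'0 : ord0 \notin leaves t' by rewrite -has_pred1 has_count t'S !inE eqxx.
(* Since x_0 does not occur in [t'], [w] vanishes at 0, and {t', x_0} fills that place in the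
   relation [wB]. *)
pose u : {ffun 'I_D.+1 -> J} :=
  [ffun i => if i == ord0 then jmonom K t' else w i].
have uX : u \in @XJpred K D.
  apply/andP; split.
    apply/forallP => i; rewrite ffunE; case: eqP => [->|//].
    exact: multilinear_monom.
  move: wB; rewrite (bigD1 ord0) //= w0 // bracket0l add0r => wB.
  rewrite (bigD1 ord0) //= ffunE eqxx -[X in _ == X]wB; apply/eqP.
  congr (_ + _).
  by apply: eq_bigr => i /negPf i0; rewrite ffunE i0.
exists (exist _ u uX); rewrite /= ffunE eqxx; exact: drop_x0_lift.
Qed.
End CyclicBijection.

(** * Images in the free associative algebra *)

Section AssociativeLift.
Variable K : fieldType.

Section Lift.
Variables (X Y : choiceType) (g : X -> tensor K Y).

Definition word_eval (w : word X) : tensor K Y :=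
  foldl (fun u x => tmul u (g x)) (g w.1) w.2.

Definition tlift : tensor K X -> tensor K Y := mlin word_eval.
HB.instance Definition _ := GRing.Linear.on tlift.

Lemma word_eval_cat w1 w2 :
  word_eval (wcat w1 w2) = tmul (word_eval w1) (word_eval w2).
Proof.
case: w1 w2 => [x s] [y t]; rewrite /word_eval /= foldl_cat /=.
by elim/last_ind: t => //= t z IH; rewrite !foldl_rcons IH tmulA.
Qed.

Lemma tlift_tmul u v : tlift (tmul u v) = tmul (tlift u) (tlift v).
Proof.
refine (@malg_ext _ _ _ (fun u => tlift (tmul u v))
  (fun u => tmul (tlift u) (tlift v)) _ _ _ u).
- by move=> a p q; rewrite tmul_linearl linearP.
- by move=> a p q; rewrite linearP tmul_linearl.
move=> x.
refine (@malg_ext _ _ _ (fun v => tlift (tmul << x >> v))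
  (fun v => tmul (tlift << x >>) (tlift v)) _ _ _ v).
- by move=> a p q; rewrite tmul_linearr linearP.
- by move=> a p q; rewrite linearP tmul_linearr.
by move=> y; rewrite /tmul mprodUU /tlift !mlinU word_eval_cat.
Qed.

Lemma tliftM : {morph tlift : u v / jmul u v}.
Proof.
move=> u v; rewrite [X in tlift X]/jmul /= /sjmul linearZ linearD /=.
by rewrite !tlift_tmul.
Qed.

Lemma tlift_gen x : tlift (tgen K x) = g x.
Proof. exact: mlinU. Qed.
End Lift.

(** Valued in all of T(V), so that coefficients of words and commutators are available. *)
Definition J_to_T (X : choiceType) : freeJ K X -> tensor K X :=
  jlift (@tgen K X).
HB.instance Definition _ X := GRing.Linear.on (@J_to_T X).

Lemma J_to_SJ_val (X : choiceType) (p : freeJ K X) : val (J_to_SJ p) = J_to_T p.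
Proof.
apply: (jmorph_eq (f := (val : SJ K X -> tensor K X) \o @J_to_SJ K X)
                  (g := @J_to_T X)).
- by move=> q r; rewrite /= [J_to_SJ _]jliftM.
- exact: jliftM.
- by move=> x; rewrite /= [J_to_SJ _]jlift_gen [RHS]jlift_gen.
Qed.

Lemma J_to_SJ_eq0 (X : choiceType) (p : freeJ K X) :
  (J_to_SJ p == 0) = (J_to_T p == 0).
Proof. by rewrite -J_to_SJ_val. Qed.

Lemma J_to_T_jlift (X Y : choiceType) (f : X -> freeJ K Y) (p : freeJ K X) :
  J_to_T (jlift f p) = tlift (fun x => J_to_T (f x)) (J_to_T p).
Proof.
suff H : @J_to_T Y \o jlift f =1
         tlift (fun x => J_to_T (f x)) \o @J_to_T X by exact: H.
apply: jmorph_eq.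
- by move=> q r; rewrite /= jliftM [LHS]jliftM.
- by move=> q r; rewrite /= [J_to_T _]jliftM tliftM.
- by move=> x; rewrite /= jlift_gen [J_to_T (jgen K x)]jlift_gen tlift_gen.
Qed.

(** A substitution of Jordan elements for generators extends to T(V), so it preserves special
    identities. *)
Lemma J_to_SJ_jlift (X Y : choiceType) (f : X -> freeJ K Y) (p : freeJ K X) :
  J_to_SJ p == 0 -> J_to_SJ (jlift f p) == 0.
Proof. by rewrite !J_to_SJ_eq0 J_to_T_jlift => /eqP ->; rewrite linear0. Qed.

(** Setting x_i to 0 kills p but leaves the coefficients of words without i unchanged. *)
Lemma J_to_T_coef0 (X : finType) (S : {set X}) (i : X) (p : freeJ K X) x s :
  i \in S -> p \in multilinear S -> i \notin x :: s -> (J_to_T p)@_(x, s) = 0.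
Proof.
move=> iS pS ixs; pose g y := J_to_T (if y == i then 0 else jgen K y).
have gE y : g y = if y == i then 0 else tgen K y.
  by rewrite /g; case: eqP => _; [rewrite linear0 | rewrite [LHS]jlift_gen].
have evalE w : (word_eval g w)@_(x, s) = (<< w >> : tensor K X)@_(x, s).
  case: w => y t; have [iyt|iyt] := boolP (i \in y :: t).
    rewrite mcoeffU; have -> : (y, t) == (x, s) = false.
      by apply: contraNF ixs => /eqP[<- <-].
    have -> : word_eval g (y, t) = 0; last by rewrite mcoeff0.
    have m0 u : tmul u 0 = 0 :> tensor K X.
      exact: linear_fun0 (tmul_linearr u).
    have m0l u : tmul 0 u = 0 :> tensor K X.
      exact: linear_fun0 (tmul_linearl u).
    elim/last_ind: t iyt => [|t z IH]; rewrite /word_eval /=.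
      by rewrite inE gE eq_sym => ->.
    rewrite -rcons_cons mem_rcons in_cons foldl_rcons (gE z).
    move=> /orP[/eqP <-|/IH].
      by rewrite eqxx m0.
    by rewrite /word_eval /= => ->; rewrite m0l.
  congr (_@__); elim/last_ind: t iyt => [|t z IH]; rewrite /word_eval /=.
    by rewrite inE gE eq_sym => /negPf ->.
  rewrite -rcons_cons mem_rcons in_cons negb_or eq_sym foldl_rcons (gE z).
  move=> /andP[/negPf -> /IH].
  by rewrite /word_eval /= => ->; rewrite /tmul mprodUU /wcat /= cats1.
have -> : (J_to_T p)@_(x, s) = (tlift g (J_to_T p))@_(x, s).
  refine (@malg_ext _ _ K^o (fun u => u@_(x, s))
    (fun u => (tlift g u)@_(x, s)) _ _ _ _).
  - by move=> a u v; rewrite mcoeffD mcoeffZ.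
  - by move=> a u v; rewrite linearP mcoeffD mcoeffZ.
  - by move=> w; rewrite /tlift mlinU evalE.
have := J_to_T_jlift (fun y => if y == i then 0 else jgen K y) p.
rewrite -/(deg0 i p) (deg0_multilinear iS pS) linear0 => <-.
exact: mcoeff0.
Qed.

Lemma tmul_gen_coefr (X : choiceType) (u : tensor K X) j x s k :
  (tmul u (tgen K j))@_(x, rcons s k) = if j == k then u@_(x, s) else 0.
Proof.
refine (@malg_ext _ _ K^o (fun u => (tmul u (tgen K j))@_(x, rcons s k))
  (fun u => if j == k then u@_(x, s) else 0) _ _ _ u).
- by move=> a p q; rewrite tmul_linearl mcoeffD mcoeffZ.
- move=> a p q; case: eqP => _; first by rewrite mcoeffD mcoeffZ.
  by rewrite scaler0 addr0.
move=> [y t]; rewrite /tmul mprodUU /wcat /= cats1 !mcoeffU.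
by rewrite !xpair_eqE eqseq_rcons; case: (j == k); rewrite ?andbT ?andbF.
Qed.

Lemma tmul_gen_coefl (X : choiceType) (u : tensor K X) j x y s :
  (tmul (tgen K j) u)@_(x, y :: s) = if j == x then u@_(y, s) else 0.
Proof.
refine (@malg_ext _ _ K^o (fun u => (tmul (tgen K j) u)@_(x, y :: s))
  (fun u => if j == x then u@_(y, s) else 0) _ _ _ u).
- by move=> a p q; rewrite tmul_linearr mcoeffD mcoeffZ.
- move=> a p q; case: eqP => _; first by rewrite mcoeffD mcoeffZ.
  by rewrite scaler0 addr0.
move=> [z t]; rewrite /tmul mprodUU /wcat /= !mcoeffU !xpair_eqE eqseq_cons.
by case: (j == x).
Qed.

(** The commutator is an admissible form: an associative element commutes with its square. *)
Lemma J_to_T_commutator_sum0 (X : choiceType) (I : finType)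
    (a b : I -> freeJ K X) :
  \sum_i bracket (a i) (b i) = 0 ->
  \sum_i (tmul (J_to_T (a i)) (J_to_T (b i)) -
          tmul (J_to_T (b i)) (J_to_T (a i))) = 0.
Proof.
pose w (p q : freeJ K X) :=
  tmul (J_to_T p) (J_to_T q) - tmul (J_to_T q) (J_to_T p).
apply: (@form_sum0 _ _ _ w); rewrite /w.
- move=> z c p q; rewrite linearP tmul_linearl tmul_linearr.
  by rewrite opprD scalerBr addrACA.
- move=> z c p q; rewrite linearP tmul_linearl tmul_linearr.
  by rewrite opprD scalerBr addrACA.
- by move=> p; rewrite subrr.
move=> p; rewrite [J_to_T (jmul p p)]jliftM -/(J_to_T p) /jmul /= /sjmul.
set u := J_to_T p.
rewrite (GRing.scalable_linear (tmul_linearr _)).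
rewrite (GRing.scalable_linear (tmul_linearl _)).
rewrite (linear_funD (tmul_linearr _)) (linear_funD (tmul_linearl _)).
by rewrite !tmulA subrr.
Qed.

Lemma XJ_special_components (D : nat) (u : XJ K D) (i : 'I_D.+1) :
  J_to_T (val u ord0) = 0 -> J_to_T (val u i) = 0.
Proof.
move=> u0; have /andP[/forallP uM /eqP uB] := valP u.
(* The sum of the images u_i x_i in T(V) is invariant under cyclic rotation  *)
(* of words: a word containing x_0 can be rotated until x_0 comes last, where *)
(* its coefficient comes from u_0.                                            *)
pose c j (s : seq 'I_D.+1) :=
  if s is x :: s then (J_to_T (val u j))@_(x, s) else 0.
(* Compare the coefficient of the word j s k in sum_l v_l x_l and in sum_l x_l v_l, where v_l is the
   image of u_l. *)
have rot_c j s k : c j (rcons s k) = c k (j :: s).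
  have hr l : (tmul (J_to_T (val u l)) (tgen K l))@_(j, rcons s k) =
              if l == k then c k (j :: s) else 0.
    by rewrite tmul_gen_coefr; case: eqP => [->|].
  have hl l : (tmul (tgen K l) (J_to_T (val u l)))@_(j, rcons s k) =
              if l == j then c j (rcons s k) else 0.
    by case: s {hr} => [|y s] /=; rewrite tmul_gen_coefl; case: eqP => [->|].
  have := congr1 (mcoeff (j, rcons s k)) (J_to_T_commutator_sum0 uB).
  rewrite mcoeff0 raddf_sum /=.
  under eq_bigr => l _ do rewrite [J_to_T (jgen K l)]jlift_gen mcoeffB hr hl.
  rewrite sumrB -!big_mkcond !big_pred1_eq => /eqP.
  by rewrite subr_eq0 => /eqP.
have c0 j p s : c j (p ++ ord0 :: s) = 0.
  elim/last_ind: s j p => [|s k IH] j p.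
    by rewrite cats1 rot_c /c u0 mcoeff0.
  by rewrite -rcons_cons -rcons_cat rot_c -cat_cons IH.
apply/malgP => [[x s]]; rewrite mcoeff0.
have [xs0|xs0] := boolP (ord0 \in x :: s).
  have -> : (J_to_T (val u i))@_(x, s) = c i (x :: s) by [].
  by case/splitPr: xs0 => p q; exact: c0.
(* Words without x_0 cannot be rotated to it, but for i nonzero u_i has degree one in x_0. *)
have [->|i0] := eqVneq i ord0; first by rewrite u0 mcoeff0.
by apply: J_to_T_coef0 (uM i) xs0; rewrite !inE eq_sym.
Qed.
End AssociativeLift.

(** * The symmetric group action and its restriction to special identities *)

Section CyclicAction.
Variables (K : fieldType) (two_neq0 : 2%:R != 0 :> K) (D : nat).

Lemma jperm1 (X : finType) (p : freeJ K X) : jperm 1%g p = p.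
Proof.
apply: (jmorph_eq (f := jperm 1%g) (g := idfun)) => [|//|x].
  exact: jliftM.
by rewrite [LHS]jlift_gen perm1.
Qed.

Lemma jpermM (X : finType) (s t : {perm X}) (p : freeJ K X) :
  jperm (s * t)%g p = jperm t (jperm s p).
Proof.
suff H : jperm (s * t)%g =1 jperm t \o @jperm K X s by exact: H.
apply: jmorph_eq => [|q r|x]; first exact: jliftM.
  by rewrite /= [jperm s _]jliftM [LHS]jliftM.
by rewrite /= [LHS]jlift_gen [jperm s _]jlift_gen [RHS]jlift_gen permM.
Qed.

Lemma XJ_perm1 (u : XJ K D) : XJ_perm 1%g u = u.
Proof. by apply/val_inj/ffunP => i; rewrite ffunE jperm1 invg1 perm1. Qed.

Lemma XJ_permM (s t : 'S_D.+1) (u : XJ K D) :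
  XJ_perm (s * t)%g u = XJ_perm t (XJ_perm s u).
Proof.
apply/val_inj/ffunP => i; rewrite /= [RHS]ffunE /=.
by rewrite [LHS]ffunE [in RHS]ffunE jpermM invMg permM.
Qed.

Lemma XJ_perm_linear (s : 'S_D.+1) : linear (@XJ_perm K D s).
Proof.
move=> a u v.
have valE (x y : XJ K D) j :
  val (a *: x + y) j = a *: val x j + val y j.
  by rewrite [val _]linearP ffunE ffunE.
apply/val_inj/ffunP => i; rewrite [RHS]valE [LHS]ffunE valE linearP.
by congr (_ *: _ + _); rewrite ffunE.
Qed.

Lemma drop_x0_jperm (s : 'S_D) (p : freeJ K 'I_D.+1) :
  drop_x0 (jperm (lift_perm ord0 ord0 s) p) = jperm s (drop_x0 p).
Proof.
suff H : @drop_x0 K D \o jperm (lift_perm ord0 ord0 s) =1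
         jperm s \o @drop_x0 K D.
  exact: H.
apply: jmorph_eq => [q r|q r|i] /=.
- by rewrite [jperm _ _]jliftM [LHS]jliftM.
- by rewrite [drop_x0 _]jliftM [LHS]jliftM.
rewrite [jperm (lift_perm _ _ _) _]jlift_gen [LHS]jlift_gen.
rewrite [drop_x0 _]jlift_gen.
case: (unliftP ord0 i) => [j ->|->].
  by rewrite lift_perm_lift liftK [RHS]jlift_gen.
by rewrite lift_perm_id unlift_none linear0.
Qed.

Lemma cyc_proj_lift_perm (s : 'S_D) (u : XJ K D) :
  cyc_proj (XJ_perm (lift_perm ord0 ord0 s) u) = calJ_perm s (cyc_proj u).
Proof.
apply: val_inj; rewrite /= ffunE drop_x0_jperm.
by rewrite -[X in val u (_ X)](lift_perm_id ord0 ord0 s) permK.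
Qed.

(** The new component at 0 is a renamed u_i, and all u_i are special identities as soon as u_0 is
    one. *)
Lemma cyc_proj_SI_perm (s : 'S_D.+1) (u : XJ K D) :
  cyc_proj u \in @SIpred K D -> cyc_proj (XJ_perm s u) \in @SIpred K D.
Proof.
move=> u0; have /andP[/forallP uM _] := valP u.
have {}u0 : J_to_T (val u ord0) = 0.
  apply/eqP; rewrite -J_to_SJ_eq0 -(drop_x0K (uM ord0)).
  exact/J_to_SJ_jlift/u0.
suff : J_to_SJ (drop_x0 (val (XJ_perm s u) ord0)) == 0 by [].
rewrite /= ffunE; do 2!apply: J_to_SJ_jlift.
by rewrite J_to_SJ_eq0 XJ_special_components.
Qed.
End CyclicAction.

Theorem corollary7 (K : fieldType) (charK : [pchar K] =i pred0)
    (D : nat) (hD : (1 <= D)%N) :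
  bijective (@cyc_proj K D) /\
  exists rho : {action 'S_D.+1 &-> SI K D},
    [/\ forall s : 'S_D.+1, linear (fun p : SI K D => rho p s),
        forall (s : 'S_D) (p : SI K D),
          val (rho p (lift_perm ord0 ord0 s)) = calJ_perm s (val p)
      & forall (s : 'S_D.+1) (u : XJ K D) (p : SI K D),
          val p = cyc_proj u -> val (rho p s) = cyc_proj (XJ_perm s u)].
Proof.
have two_neq0 : 2%:R != 0 :> K by move/pcharf0P: charK => ->.
(* A chosen section of [cyc_proj]; injectivity makes it a two-sided inverse, along which the action
   is transported. *)
pose g (p : calJ K D) := sval (cid (cyc_proj_surj two_neq0 p)).
have gK : cancel g (@cyc_proj K D) by move=> p; rewrite /g; case: cid.
have Kg := inj_can_sym gK (@cyc_proj_inj K two_neq0 D).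
split; first by exists g.
have gSI s (p : SI K D) : cyc_proj (XJ_perm s (g (val p))) \in @SIpred K D.
  by apply: cyc_proj_SI_perm; rewrite gK; exact: valP.
pose to (p : SI K D) s : SI K D :=
  exist _ (cyc_proj (XJ_perm s (g (val p)))) (gSI s p).
have to1 p : to p 1%g = p by apply: val_inj; rewrite /= XJ_perm1 gK.
have toM p : act_morph to p.
  by move=> s t; apply: val_inj; rewrite /= Kg XJ_permM.
exists (TotalAction to1 toM); split=> [s a p q|s p|s u p pu]; rewrite /=.
- apply: val_inj => /=; rewrite -linearP -XJ_perm_linear.
  congr (cyc_proj (XJ_perm s _)).
  by apply: (@cyc_proj_inj K two_neq0 D); rewrite linearP /= !gK.
- by rewrite cyc_proj_lift_perm gK.
- by rewrite pu Kg.
Qed.
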